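(* Let $G$ be a countably infinite discrete group that is abelian, or more generally FC (every conjugacy class of $G$ is finite), and let $G\curvearrowright X$ be a free action by homeomorphisms on a compact metrizable space. Then the action has the marker property if and only if it has URPC (the Uniform Rokhlin Property and comparison).
   Context: A set $U\subset X$ is $L$-free (for finite $L\subset G$) if the translates $gU$, $g\in L$, are pairwise disjoint. A marker set is an open set $U\subset X$ with $GU=\bigcup_{g\in G}gU=X$. The action has the marker property if for every finite $L\subset G$ there is an $L$-free marker set. A finite set $S\subset G$ is $(K,\varepsilon)$-invariant if $\left|\bigcap_{g\in K}gS\right|>(1-\varepsilon)|S|$. For $A\subset X$ the upper Banach density is $\overline{D}(A)=\inf_F\sup_{x\in X}\frac{|A\cap Fx|}{|F|}$, the infimum being over nonempty finite $F\subset G$. A tower is a pair $(S,V)$ with $S\subset G$ finite (the shape) and $V\subset X$ open such that $V$ is $S$-free; $SV=\bigcup_{g\in S}gV$. A castle is a finite collection of towers $\{(S_i,V_i)\}_{i=1}^n$ with the sets $S_iV_i$ pairwise disjoint. URP: for every finite $K\subset G$ and every $\varepsilon>0$ there is a castle $\{(S_i,V_i)\}_{i=1}^n$ whose shapes are $(K,\varepsilon)$-invariant and such that $\overline{D}\left(X\setminus\bigsqcup_{i=1}^nS_iV_i\right)<\varepsilon$. Comparison: for $A\subset X$ closed and $B\subset X$ open write $A\prec B$ if there are finitely many open sets $U_j$ covering $A$ and $g_j\in G$ such that the sets $g_jU_j$ are pairwise disjoint subsets of $B$. The action has comparison if $A\prec B$ whenever $A$ is closed, $B$ is open and $\mu(A)<\mu(B)$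 for every $G$-invariant Borel probability measure $\mu$ on $X$. URPC means URP together with comparison. *)

(* Defs.v *)
From HB Require Import structures.
From mathcomp Require Import all_boot all_order all_algebra finmap.
From mathcomp Require Import all_classical all_reals all_analysis.

Set Implicit Arguments.
Unset Strict Implicit.
Unset Printing Implicit Defensive.

Import Order.TTheory GRing.Theory Num.Theory.

Local Open Scope classical_set_scope.
Local Open Scope ring_scope.

Definition countably_infinite (T : Type) : Prop :=
  ([set: T] #= [set: nat])%card.

Definition FC_group (G : groupType) : Prop :=
  forall x : G, finite_set [set conjg x y | y in [set: G]].

Lemma abelian_FC_group (G : groupType) :
  (forall x y : G, commute x y) -> FC_group G.
Proof.
move=> cG x; apply: (@sub_finite_set _ _ [set x]); last exact: finite_set1.
by move=> _ [y _ <-] /=; rewrite /conjg (cG x y) mulKg.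
Qed.

Definition metrizable (R : realType) (X : topologicalType) : Prop :=
  exists (M : metricType R) (f : X -> M) (h : M -> X),
    [/\ cancel f h, cancel h f, continuous f & continuous h].

Definition is_left_action (G : groupType) (X : Type) (a : G -> X -> X) : Prop :=
  (forall x, a 1%g x = x) /\ (forall g h x, a (g * h)%g x = a g (a h x)).

Definition is_free_action (G : groupType) (X : Type) (a : G -> X -> X) : Prop :=
  forall g x, a g x = x -> g = 1%g.

(* Each [a g] is then a homeomorphism, with inverse [a g^-1]. *)
Definition acts_by_homeomorphisms (G : groupType) (X : topologicalType)
    (a : G -> X -> X) : Prop :=
  is_left_action a /\ (forall g, continuous (a g)).

Definition is_lfree (G : groupType) (X : Type) (a : G -> X -> X)
    (L : {fset G}) (U : set X) : Prop :=
  trivIset [set` L] (fun g => a g @` U).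

Definition is_marker (G : groupType) (X : topologicalType) (a : G -> X -> X)
    (U : set X) : Prop :=
  open U /\ \bigcup_g (a g @` U) = [set: X].

Definition marker_property (G : groupType) (X : topologicalType)
    (a : G -> X -> X) : Prop :=
  forall L : {fset G}, exists U : set X, is_marker a U /\ is_lfree a L U.

(* [counting] takes the value +oo on infinite sets, so the condition is
   vacuous for K empty, the intersection then being the whole group. *)
Definition is_invariant_shape (R : realType) (G : groupType) (K : {fset G})
    (e : R) (S : {fset G}) : Prop :=
  (((1 - e) * #|` S|%:R)%:E
     < counting (\bigcap_(g in [set` K]) [set (g * s)%g | s in [set` S]]))%E.

(* The set of ratios is contained in [0, 1], so that real-valued [sup] and [inf]
   are meaningful; if X is empty, [sup set0 = 0]. *)
Definition upper_banach_density (R : realType) (G : groupType)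
    (X : choiceType) (a : G -> X -> X) (A : set X) : R :=
  inf [set sup [set #|` fset_set (A `&` [set a g x | g in [set` F]])|%:R
                      / #|` F|%:R
               | x in [set: X]]
      | F in [set F : {fset G} | F != fset0]].

Definition levels (G : groupType) (X : Type) (a : G -> X -> X)
    (S : {fset G}) (V : set X) : set X :=
  \bigcup_(g in [set` S]) (a g @` V).

Definition is_tower (G : groupType) (X : topologicalType) (a : G -> X -> X)
    (S : {fset G}) (V : set X) : Prop :=
  open V /\ is_lfree a S V.

Definition is_castle (G : groupType) (X : topologicalType) (a : G -> X -> X)
    (n : nat) (S : 'I_n -> {fset G}) (V : 'I_n -> set X) : Prop :=
  (forall i, is_tower a (S i) (V i)) /\
  trivIset [set: 'I_n] (fun i => levels a (S i) (V i)).

Definition URP (R : realType) (G : groupType) (X : topologicalType)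
    (a : G -> X -> X) : Prop :=
  forall (K : {fset G}) (e : R), 0 < e ->
    exists (n : nat) (S : 'I_n -> {fset G}) (V : 'I_n -> set X),
      [/\ is_castle a S V,
          forall i, is_invariant_shape K e (S i) &
          upper_banach_density R a (~` (\bigcup_i levels a (S i) (V i))) < e].

(* Measurable types are pointed in the library, whereas X may be empty. Since an
   empty space carries no probability measure, nothing is lost by quantifying
   over a base point [x0] alongside the measure; neither the Borel sigma-algebra
   nor its measures depend on [x0]. *)
Definition pointed_at (X : Type) (x0 : X) : Type := X.
HB.instance Definition _ (X : topologicalType) (x0 : X) :=
  Topological.copy (pointed_at x0) X.
HB.instance Definition _ (X : topologicalType) (x0 : X) :=
  isPointed.Build (pointed_at x0) x0.

Definition borel (X : topologicalType) (x0 : X) : measurableType _ :=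
  g_sigma_algebraType (@open (pointed_at x0)).

Definition is_invariant_measure (R : realType) (G : groupType)
    (X : topologicalType) (a : G -> X -> X) (x0 : X)
    (mu : probability (borel x0) R) : Prop :=
  forall (g : G) (E : set (borel x0)), measurable E -> mu (a g @` E) = mu E.

Definition is_subequivalent (G : groupType) (X : topologicalType)
    (a : G -> X -> X) (A B : set X) : Prop :=
  exists (n : nat) (U : 'I_n -> set X) (g : 'I_n -> G),
    [/\ forall j, open (U j),
        A `<=` \bigcup_j U j,
        trivIset [set: 'I_n] (fun j => a (g j) @` U j) &
        forall j, a (g j) @` U j `<=` B].

Definition comparison (R : realType) (G : groupType) (X : topologicalType)
    (a : G -> X -> X) : Prop :=
  forall A B : set X, closed A -> open B ->
    (forall (x0 : X) (mu : probability (borel x0) R),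
       is_invariant_measure a mu -> (mu A < mu B)%E) ->
    is_subequivalent a A B.

Definition URPC (R : realType) (G : groupType) (X : topologicalType)
    (a : G -> X -> X) : Prop :=
  URP R a /\ comparison R a.

(* Main.v *)
Require Import Defs.
From HB Require Import structures.
From mathcomp Require Import all_boot all_order all_algebra finmap.
From mathcomp Require Import all_classical all_reals all_analysis.
From mathcomp Require Import zify ring lra.

(** If the action has URP, a castle with (K, e)-invariant shapes, K containing 1 and the
    inverses of L, yields an L-free marker: keep one level [t] in each tower, with [L t]
    inside the shape. The resulting set meets every orbit because the castle does.

    Conversely, let the action have the marker property. Finitely generated FC groups have
    polynomial growth. Given [g <> 1] and a marker [U = {phi > 0}] that is free for the
    conjugacy class of [g], a greedy maximal independent set along the [g]-lines, with
    thresholds on [phi] that vary along the line, gives a locally constant 3-coloring that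
    separates [x] from [g x] off a closed set covered by two sets subequivalent to [U].
    Products of such colorings separate a whole ball. Carving balls of controlled growth
    out of the orbits, color by color, and gluing the pieces around a well spread set of
    centers, gives a castle with invariant shapes whose complement is covered by [k] sets
    subequivalent to [U], where [k] does not depend on [U].

    Every invariant mean of the complement is therefore at most [k / |L|] for every L, which
    is URP. For comparison, suppose that mu(A) < mu(B) for all mu. Regularising invariant
    means into Borel measures gives a finite set E such that every orbit piece [E x] meets
    B more often than A. In B one reserves [k] disjoint open sets, each met by every orbit
    piece [E' x] of some fixed shape E'. If [U] is E'-free, it is subequivalent to each of
    them, so the complement of the castle is subequivalent to their union; inside the
    towers, A is matched with what remains of B level by level. *)

Set Implicit Arguments.
Unset Strict Implicit.
Unset Printing Implicit Defensive.

Import Order.TTheory GRing.Theory Num.Theory.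
Import numFieldNormedType.Exports.

(** * Growth of FC groups *)

Lemma card_fset_le_range (K : choiceType) (T : finType) (A : {fset K})
    (f : T -> K) :
  (forall x, x \in A -> exists t, f t = x) -> (#|` A| <= #|T|)%N.
Proof.
move=> fA; have /fsubset_leq_card : (A `<=` [fset x in map f (enum T)])%fset.
  apply/fsubsetP => x /fA[t <-]; rewrite in_fset /=.
  by apply: map_f; rewrite mem_enum.
move/leq_trans; apply; rewrite card_fseq (leq_trans (size_undup _)) //.
by rewrite size_map cardE.
Qed.

Section Growth.
Variables (G : groupType) (Sg : {fset G}).
Hypothesis Sg1 : 1%g \in Sg.
Hypothesis SgV : forall s, s \in Sg -> (s^-1)%g \in Sg.
Hypothesis SgJ : forall s t, s \in Sg -> t \in Sg -> conjg s t \in Sg.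

Local Open Scope group_scope.
Local Open Scope fset_scope.

(** Products of exactly [n] elements of [Sg]; since [Sg] contains 1, these are the balls of the word
    length. *)
Fixpoint gball (n : nat) : {fset G} :=
  if n is n'.+1 then [fset x * y | x in Sg, y in gball n'] else [fset 1%g].

Definition word_prod (w : seq G) : G := foldr (fun x y => x * y) 1 w.

Lemma word_prod_cat v w : word_prod (v ++ w) = word_prod v * word_prod w.
Proof. by elim: v => [|x v IH] /=; rewrite ?mul1g // IH mulgA. Qed.

Lemma gballP n x :
  reflect (exists w, [/\ size w = n, {subset w <= Sg} & word_prod w = x])
          (x \in gball n).
Proof.
elim: n x => [|n IH] x /=.
  rewrite in_fset1; apply: (iffP eqP) => [->|]; first by exists [::]; split.
  by case=> w [] /size0nil -> _ <-.
apply: (iffP (imfset2P _ _ _ _ _)) => /= [[s sS [y /IH[w [ws wS <-]] ->]]|].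
  exists (s :: w); split=> //=; first by rewrite ws.
  by move=> t; rewrite inE => /orP[/eqP -> //|/wS].
case=> -[|s w] [] //= [ws] wS <-; exists s; first by apply: wS; rewrite mem_head.
exists (word_prod w) => //; apply/IH; exists w; split=> // t tw.
by apply: wS; rewrite inE tw orbT.
Qed.

Lemma gball_mul m n x y : x \in gball m -> y \in gball n -> x * y \in gball (m + n).
Proof.
move=> /gballP[v [<- vS <-]] /gballP[w [<- wS <-]]; apply/gballP; exists (v ++ w).
split; rewrite ?size_cat ?word_prod_cat // => t.
by rewrite mem_cat => /orP[/vS|/wS].
Qed.

Lemma gball_one n : 1%g \in gball n.
Proof.
apply/gballP; exists (nseq n 1%g); split; rewrite ?size_nseq //.
  by move=> t; rewrite mem_nseq => /andP[_ /eqP ->].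
by elim: n => //= n ->; rewrite mulg1.
Qed.

Lemma gball_le m n x : (m <= n)%N -> x \in gball m -> x \in gball n.
Proof.
by move=> mn xm; rewrite -(subnKC mn) -[x]mulg1 gball_mul // gball_one.
Qed.

Lemma gball_gen s : s \in Sg -> s \in gball 1.
Proof.
move=> sS; apply/gballP; exists [:: s]; split=> //=; last by rewrite mulg1.
by move=> t; rewrite inE => /eqP ->.
Qed.

Lemma gball_inv n x : x \in gball n -> x^-1 \in gball n.
Proof.
elim: n x => [|n IH] x.
  by rewrite !in_fset1 => /eqP ->; rewrite invg1.
case/imfset2P => /= s sS [y yn ->]; rewrite invgM.
by have := gball_mul (IH _ yn) (gball_gen (SgV sS)); rewrite addn1.
Qed.

Lemma card_gball_gt0 n : (0 < #|` gball n|)%N.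
Proof. by rewrite cardfs_gt0; apply/fset0Pn; exists 1%g; exact: gball_one. Qed.

Lemma subset_gball m n : (m <= n)%N -> gball m `<=` gball n.
Proof. by move=> mn; apply/fsubsetP => x; exact: gball_le. Qed.

Let e := (#|` Sg|)`!.
Let M := (#|` Sg| * e)%N.

(* Conjugation by [s] permutes [Sg], so its order divides [#|Sg|!]. *)
Lemma factorial_power_commute s x :
  s \in Sg -> x \in Sg -> commute x (s ^+ e).
Proof.
move=> sS xS; have [p [p0 pS xp]] :
    exists p, [/\ (0 < p)%N, (p <= #|` Sg|)%N & x ^ (s ^+ p) = x].
  have inS i : x ^ (s ^+ i) \in Sg.
    elim: i => [|i IH]; first by rewrite expg0 conjg1.
    by rewrite expgSr conjgM SgJ.
  have nu : ~~ uniq (mkseq (fun i => x ^ (s ^+ i)) #|` Sg|.+1).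
    apply/negP => u; have := uniq_leq_size u (s2 := enum_fset Sg).
    rewrite size_mkseq ltnn => /(_ _)/notF; apply => y.
    by move=> /mapP[i _ ->]; exact: inS.
  have /(uniqPn 1%g)[i [j [ij]]] := nu; rewrite size_mkseq ltnS => jS.
  rewrite !nth_mkseq ?ltnS ?(leq_trans (ltnW ij)) // => eij.
  exists (j - i)%N; split; [by rewrite subn_gt0| |].
    by rewrite (leq_trans (leq_subr _ _)).
  apply: (@conjg_inj _ (s ^+ i)); rewrite -conjgM -expgnDr subnK //.
  exact: ltnW.
have fixk k : x ^ (s ^+ (p * k)) = x.
  elim: k => [|k IH]; first by rewrite muln0 expg0 conjg1.
  by rewrite mulnS expgnDr conjgM xp IH.
have /dvdnP[k ek] : (p %| e)%N by rewrite dvdn_fact // p0.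
by have := fixk k; rewrite mulnC -ek => h; rewrite /commute conjgC h.
Qed.

(** An occurrence of [s] moves to the front by [u * s = s * u ^ s], which conjugates the letters
    before it. They stay in [Sg], and as many of them as before equal [s], because conjugation by
    [s] is injective and fixes [s]; so the move can be repeated. *)
Lemma word_extract s (k : nat) w : {subset w <= Sg} -> s \in Sg ->
  (k <= count_mem s w)%N ->
  exists w', [/\ {subset w' <= Sg}, size w = (size w' + k)%N &
                 word_prod w = s ^+ k * word_prod w'].
Proof.
move=> wS sS; elim: k w wS => [|k IH] w wS kw.
  by exists w; rewrite addn0 expg0 mul1g.
have sw : s \in w by rewrite -has_pred1 has_count (leq_trans _ kw).
case/splitPr: sw wS kw => x y wS kw.
have xS t : t \in x -> t \in Sg by move=> tx; apply: wS; rewrite mem_cat tx.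
have yS t : t \in y -> t \in Sg.
  by move=> ty; apply: wS; rewrite mem_cat inE ty !orbT.
have cx u : count_mem s [seq conjg t s | t <- u] = count_mem s u.
  have ss : conjg s s = s by rewrite conjgE mulKg.
  by elim: u => //= t u ->; rewrite -{2}ss (inj_eq (@conjg_inj _ s)).
have px u : word_prod u * s = s * word_prod [seq conjg t s | t <- u].
  elim: u => [|t u IHu] /=; first by rewrite mul1g mulg1.
  by rewrite -mulgA IHu !mulgA mulgV mul1g.
have [||w' [w'S sw' pw']] := IH ([seq conjg t s | t <- x] ++ y).
- move=> t; rewrite mem_cat => /orP[/mapP[u ux ->]|/yS //].
  exact: SgJ (xS u ux) sS.
- by move: kw; rewrite !count_cat cx /= eqxx add1n addnS ltnS.
exists w'; split=> //.
  by move: sw'; rewrite !size_cat size_map /=; lia.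
rewrite word_prod_cat /= mulgA px -mulgA -word_prod_cat pw' expgS !mulgA.
by [].
Qed.

Let kappa := #|` Sg|.
Let sg (i : 'I_kappa) : G := nth 1%g (enum_fset Sg) i.

Lemma sg_in i : sg i \in Sg.
Proof. by rewrite /sg; apply: mem_nth; exact: ltn_ord. Qed.

(** By the pigeonhole principle a word longer than [M] contains some letter at least [e] times. The
    [e]-th power of this letter is extracted, and it commutes with every generator; induction on the
    length. *)
Lemma word_normal_form w : {subset w <= Sg} ->
  exists (b : 'I_kappa -> nat) w',
    [/\ {subset w' <= Sg}, (size w' <= M)%N, forall i, (b i <= size w)%N &
        word_prod w = (\prod_i (sg i ^+ e) ^+ b i) * word_prod w'].
Proof.
move: {2}(size w) (leqnn (size w)) => n; elim: n w => [|n IH] w wn wS.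
  exists (fun=> 0), [::]; split=> //; move: wn; rewrite leqn0 size_eq0 => /eqP ->.
  by rewrite big1 ?mulg1 // => i _; rewrite expg0.
have [wM|Mw] := leqP (size w) M.
  exists (fun=> 0), w; split=> //.
  by rewrite big1 ?mul1g // => i _; rewrite expg0.
have e0 : (0 < e)%N by rewrite fact_gt0.
have [i iw] : exists i : 'I_kappa, (e <= count_mem (sg i) w)%N.
  apply/existsP; apply: contraTT Mw; rewrite -leqNgt negb_exists => /forallP h.
  have -> : size w = (\sum_(s <- enum_fset Sg) count_mem s w)%N.
    elim: w wS {wn h} => [|t w IHw] wS /=; first by rewrite big1.
    rewrite big_split /= -IHw; last by move=> x xw; apply: wS; rewrite inE xw orbT.
    rewrite (bigD1_seq t) ?wS ?mem_head //= eqxx big1 // => s /negPf.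
    by rewrite eq_sym => ->.
  rewrite (big_nth 1%g) big_mkord /M.
  have -> : (#|` Sg| * e = \sum_(j < size (enum_fset Sg)) e)%N.
    by rewrite sum_nat_const card_ord.
  by apply: leq_sum => j _; have := h j; rewrite -ltnNge => /ltnW.
have [w1 [w1S sw1 pw1]] := word_extract wS (sg_in i) iw.
have [|b [w' [w'S w'M bw pw']]] := IH w1 _ w1S; first by lia.
exists (fun j => (b j + (j == i))%N), w'; split=> //.
  by move=> j; have := bw j; case: (j == i); lia.
rewrite pw1 pw' mulgA; congr (_ * _).
have cen j (x : G) : x \in Sg -> commute x (sg j ^+ e).
  by move=> xS; apply: factorial_power_commute => //; exact: sg_in.
have zc j k : commute (sg j ^+ e) (sg k ^+ e).
  by apply: commuteX; apply: commute_sym; apply: cen; exact: sg_in.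
under [in RHS]eq_bigr do rewrite expgnDr.
rewrite prodgM_commute; last first.
  by move=> *; apply: commuteX2; exact: zc.
have -> : \prod_(j : 'I_kappa) (sg j ^+ e) ^+ (j == i) = sg i ^+ e.
  rewrite (eq_bigr (fun j => if j == i then sg j ^+ e else 1)); last first.
    by move=> j _; case: (j == i); rewrite ?expg0 ?expg1.
  by rewrite -big_mkcond big_pred1_eq.
by apply: commute_prod => j _; apply: commuteX; exact: zc.
Qed.

(** Count of the normal forms: each exponent takes at most [n + 1] values, and the remaining word
    lies in [gball M]. *)
Lemma card_gball_polynomial n : (#|` gball n| <= n.+1 ^ kappa * #|` gball M|)%N.
Proof.
pose f (u : {ffun 'I_kappa -> 'I_n.+1} * gball M) : G :=
  (\prod_i (sg i ^+ e) ^+ (u.1 i)) * val u.2.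
have -> : (n.+1 ^ kappa * #|` gball M| =
          #|{: {ffun 'I_kappa -> 'I_n.+1} * gball M}|)%N.
  by rewrite card_prod card_ffun !card_ord cardfE.
apply: (@card_fset_le_range _ _ _ f) => x /gballP[w [wn wS <-]].
have [b [w' [w'S w'M bw ->]]] := word_normal_form wS.
have w'B : word_prod w' \in gball M.
  by apply: gball_le w'M _; apply/gballP; exists w'; split.
exists ([ffun i => inord (b i)], [` w'B]).
rewrite /f /=; congr (_ * _); apply: eq_bigr => i _.
by rewrite ffunE inordK // ltnS -wn.
Qed.
End Growth.

(** * Carving of a colored orbit *)

Lemma card_fset_sum_mem (K : choiceType) (A B : {fset K}) :
  (A `<=` B)%fset -> #|` A| = (\sum_(z <- enum_fset B) (z \in A))%N.
Proof.
move=> /fsubsetP AB; transitivity (count (mem A) (enum_fset B)); last first.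
  by rewrite -sum1_count big_mkcond; apply: eq_bigr => z _ /=; case: (z \in A).
rewrite -size_filter; apply: perm_size; apply: uniq_perm; rewrite ?filter_uniq ?fset_uniq //.
by move=> z; rewrite mem_filter /=; case: (boolP (z \in A)) => //= /AB ->.
Qed.

Lemma sum_card_disjoint (I K : choiceType) (W : {fset I}) (C : I -> {fset K})
    (B : {fset K}) :
  (forall w, w \in W -> (C w `<=` B)%fset) ->
  (forall w w' z, w \in W -> w' \in W -> z \in C w -> z \in C w' -> w = w') ->
  (\sum_(w <- enum_fset W) #|` C w| <= #|` B|)%N.
Proof.
move=> CB CC; rewrite (eq_big_seq _ (fun w wW => card_fset_sum_mem (CB w wW))).
rewrite exchange_big /= card_fset_sum1 /=.
apply: leq_sum => z _.
have [[w wW zw]|none] := @hasP _ (fun w => z \in C w) (enum_fset W).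
  rewrite (bigD1_seq w) ?fset_uniq //= zw big1_seq // => w' /andP[w'w w'W].
  by case: (boolP (z \in C w')) => // zw'; rewrite (CC _ _ _ w'W wW zw' zw) eqxx in w'w.
rewrite big1_seq // => w /andP[_ wW]; case: (boolP (z \in C w)) => // zw.
by case: none; exists w.
Qed.

Lemma card_le_sum_cover (I K : choiceType) (W : {fset I}) (C : I -> {fset K})
    (A : {fset K}) :
  (forall z, z \in A -> exists2 w, w \in W & z \in C w) ->
  (#|` A| <= \sum_(w <- enum_fset W) #|` C w|)%N.
Proof.
move=> AC; apply: leq_trans (_ : #|` \bigcup_(w <- enum_fset W) C w|%fset <= _)%N.
  apply: fsubset_leq_card; apply/fsubsetP => z /AC[w wW zw].
  by apply/bigfcupP; exists w => //; rewrite wW.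
elim: (enum_fset W) => [|w s IH]; first by rewrite !big_nil cardfs0.
by rewrite !big_cons (leq_trans (leq_card_fsetU _ _)) // leq_add2l.
Qed.

Lemma in_fset_sep (K : choiceType) (A : {fset K}) (P : pred K) x :
  (x \in [fset y in A | P y]%fset) = (x \in A) && P x.
Proof. by rewrite in_fset. Qed.

Lemma card_fset_image (K K' : choiceType) (A : {fset K}) (f : K -> K') :
  injective f -> #|` [fset f x | x in A]%fset| = #|` A|.
Proof. by move=> f_inj; rewrite card_imfset. Qed.

Section Carving.
Variables (G : groupType) (Sg : {fset G}).
Hypothesis Sg1 : 1%g \in Sg.
Hypothesis SgV : forall s, s \in Sg -> (s^-1)%g \in Sg.
Notation gball := (gball Sg).

Variables (X : Type) (a : G -> X -> X).
Hypothesis a1 : forall x, a 1%g x = x.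
Hypothesis aM : forall g h x, a (g * h)%g x = a g (a h x).
Hypothesis aF : forall g x, a g x = x -> g = 1%g.

Lemma act_inj g h x : a g x = a h x -> g = h.
Proof.
move=> gh; apply/eqP; rewrite -divg_eq1; apply/eqP.
have := @aF (h^-1 * g)%g x; rewrite aM gh -aM mulVg a1 => /(_ erefl) hg.
by rewrite -[g](mulVKg h) hg mulg1 mulgV.
Qed.

Lemma actK g x : a g^-1 (a g x) = x.
Proof. by rewrite -aM mulVg a1. Qed.

Lemma actKV g x : a g (a g^-1 x) = x.
Proof. by rewrite -aM mulgV a1. Qed.

Variables (R : archiRealFieldType) (e1 : R) (n1 n2 m : nat).

Section Colored.
Variable c : X -> nat.

Definition cnt (P : X -> bool) k v := #|` [fset s in gball k | P (a s v)]%fset|.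

Definition rho (P : X -> bool) v :=
  find (fun i => (cnt P i.+1 v)%:R <= (1 + e1) * (cnt P i v)%:R)%R (iota 0 n1).

(* What is left after the stages [i < j]: at stage [i] every remaining point of color
   [i] removes the ball of radius [rho] around it. *)
Fixpoint rem j : X -> bool :=
  if j is i.+1 then fun z =>
    rem i z && ~~ has (fun g => [&& c (a g z) == i, rem i (a g z) &
      (g^-1)%g \in gball (rho (rem i) (a g z))]) (enum_fset (gball n1))
  else fun=> true.

(* [own g j z]: the point [z] is carved at stage [j] by the center [a g z]. *)
Definition own g j z := [&& g \in gball n1, c (a g z) == j, rem j z, rem j (a g z) &
  (g^-1)%g \in gball (rho (rem j) (a g z))].

(** The stage at which [z] is carved is not known beforehand, hence the search; by [own_uniq] the
    list has at most one member. *)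
Definition owner z : G := head 1%g
  [seq g <- enum_fset (gball n1) | has (fun j => own g j z) (iota 0 m)].

(* Greedily, color by color, a maximal set of points no two of which differ by an
   element of [gball (2 * n2)]. *)
Fixpoint inn j : X -> bool :=
  if j is i.+1 then fun z =>
    inn i z || (c z == i) && ~~ has (fun g => inn i (a g z)) (enum_fset (gball (2 * n2)))
  else fun=> false.

(* [gball n2] comes first, so that the hub of a point near a member of [inn m] is that
   member, whose cell is therefore not empty. *)
Definition hub z : G := head 1%g
  [seq g <- enum_fset (gball n2) ++ enum_fset (gball (2 * n2)) | inn m (a g z)].

(** The carved balls are glued: all points of a ball go to the hub of its center. *)
Definition center z : G := (hub (a (owner z) z) * owner z)%g.

Lemma rho_le P v : (rho P v <= n1)%N.
Proof. by rewrite /rho -[X in (_ <= X)%N](size_iota 0) find_size. Qed.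

Lemma rem_le j k z : (j <= k)%N -> rem k z -> rem j z.
Proof.
move=> jk; elim: k jk => [|k IH]; first by rewrite leqn0 => /eqP ->.
by rewrite leq_eqVlt => /orP[/eqP -> //|]; rewrite ltnS => /IH h /= /andP[/h].
Qed.

Lemma own_carved g j z : own g j z -> ~~ rem j.+1 z.
Proof.
case/and5P => gB cg rz rg gr; rewrite /= rz /= negbK; apply/hasP; exists g => //.
by rewrite cg rg gr.
Qed.

(** Only the colors below [m] are proper; any other value marks a point left uncolored. *)
Hypothesis color_sep : forall z g, (c z < m)%N -> g \in gball (4 * n2) -> g != 1%g ->
  c (a g z) != c z.
Hypothesis n12 : (3 * n1 + 1 <= n2)%N.

Lemma sep_eq z g h : (c (a g z) < m)%N -> c (a g z) = c (a h z) ->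
  (h * g^-1)%g \in gball (4 * n2) -> g = h.
Proof.
move=> cm cc hg; apply/eqP; apply: contraT => gh.
have hg1 : (h * g^-1)%g != 1%g by rewrite divg_eq1 eq_sym.
by have := color_sep cm hg hg1; rewrite -aM mulgVK -cc eqxx.
Qed.

(** A point carved at one stage does not remain at later ones, so the stages agree. Both centers
    then have the same color and are within distance [2 * n1] of each other, so they coincide. *)
Lemma own_uniq g j h k z : (j < m)%N -> (k < m)%N -> own g j z -> own h k z ->
  g = h /\ j = k.
Proof.
move=> jm km og oh; have jk : j = k.
  have [jk|kj|//] := ltngtP j k.
    by have := own_carved og; case/and5P: oh => _ _ h3 _ _; rewrite (rem_le jk h3).
  by have := own_carved oh; case/and5P: og => _ _ h3 _ _; rewrite (rem_le kj h3).
split=> //; case/and5P: og => gB /eqP cg _ _ _; case/and5P: oh => hB /eqP ch _ _ _.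
apply: (@sep_eq z); rewrite ?cg ?ch //.
apply: (@gball_le _ _ Sg1 (n1 + n1)); first by move: n12; lia.
by rewrite gball_mul // gball_inv.
Qed.

(** At the stage of its own color, [z] either still remains and carves a ball containing itself, or
    has been carved before. *)
Lemma own_exists z : (c z < m)%N -> exists g j, (j < m)%N /\ own g j z.
Proof.
move=> cz; have [rz|nrz] := boolP (rem (c z) z).
  exists 1%g, (c z); split=> //; rewrite /own a1 eqxx rz invg1 !gball_one //.
have : exists j, (j <= c z)%N && ~~ rem j z by exists (c z); rewrite leqnn.
case/ex_minnP => -[//|j] /andP[jc nr] mn; have rj : rem j z.
  apply: contraT => nrj; suff : (j < j)%N by rewrite ltnn.
  by apply: mn; rewrite nrj (ltnW jc).
move: nr => /=; rewrite rj /= negbK => /hasP[g gB /and3P[cg rg gr]].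
exists g, j; split; first by lia.
by rewrite /own gB cg rj rg gr.
Qed.

Lemma ownerP z : (c z < m)%N -> exists j, (j < m)%N /\ own (owner z) j z.
Proof.
move=> /own_exists[g [j [jm og]]]; rewrite /owner.
set s := [seq _ <- _ | _].
have : g \in s.
  rewrite mem_filter; apply/andP; split; last by case/and5P: og.
  by apply/hasP; exists j => //; rewrite mem_iota add0n.
have : all (fun g => has (fun j => own g j z) (iota 0 m)) s by exact: filter_all.
case: s => // h s /= /andP[/hasP[k km oh] _] _; exists k; split=> //.
by move: km; rewrite mem_iota add0n.
Qed.

Lemma inn_le j k z : (j <= k)%N -> inn j z -> inn k z.
Proof.
move=> jk; elim: k jk => [|k IH]; first by rewrite leqn0 => /eqP ->.
by rewrite leq_eqVlt => /orP[/eqP -> //|]; rewrite ltnS => /IH h /= /h ->.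
Qed.

Lemma inn_color j z : inn j z -> (c z < j)%N /\ inn (c z).+1 z.
Proof.
elim: j => //= j IH /orP[/IH[h1 h2]|/andP[/eqP cz h]]; first by split=> //; lia.
by subst j; rewrite eqxx h orbT.
Qed.

(** Two distinct chosen points this close would have different colors, and the one of larger color
    would have been rejected because of the other. *)
Lemma inn_sep z g : inn m z -> inn m (a g z) -> g \in gball (2 * n2) -> g = 1%g.
Proof.
move=> iz ig gB; apply/eqP; apply: contraT => g1.
have main w h : inn m w -> inn m (a h w) -> h \in gball (2 * n2) ->
    (c (a h w) < c w)%N -> False.
  move=> iw ih hB ch; have [_ /=] := inn_color iw; rewrite eqxx /= => /orP[/inn_color[]|].
    by rewrite ltnn.
  move=> /hasPn /(_ h hB) /negP; apply.
  by apply: inn_le ch _; have [] := inn_color ih.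
have [cm _] := inn_color iz.
have gB4 : g \in gball (4 * n2) by apply: gball_le gB => //; lia.
have := color_sep cm gB4 g1; rewrite neq_ltn => /orP[] h; first by case: (main z g iz ig gB h).
have := @main (a g z) (g^-1)%g; rewrite actK => /(_ ig iz _ h) []//.
exact: gball_inv.
Qed.

Lemma inn_cover z : (c z < m)%N -> exists2 g, g \in gball (2 * n2) & inn m (a g z).
Proof.
move=> cz; have [h|h] := boolP (has (fun g => inn (c z) (a g z)) (enum_fset (gball (2 * n2)))).
  by case/hasP: h => g gB ig; exists g => //; apply: inn_le ig; exact: ltnW.
exists 1%g; first exact: gball_one.
by rewrite a1; apply: (inn_le cz); rewrite /= eqxx h orbT.
Qed.

Lemma hubP z : (c z < m)%N -> hub z \in gball (2 * n2) /\ inn m (a (hub z) z).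
Proof.
move=> /inn_cover[g gB ig]; rewrite /hub; set s := [seq _ <- _ | _].
have : g \in s by rewrite mem_filter ig mem_cat gB orbT.
have : all (fun g => inn m (a g z)) s by exact: filter_all.
have : {subset s <= gball (2 * n2)}.
  move=> h; rewrite mem_filter mem_cat => /andP[_ /orP[]//].
  by apply: (gball_le Sg1); lia.
case: s => // h s sB /= /andP[ih _] _; split=> //; apply: sB; exact: mem_head.
Qed.

Lemma hub_near z g : g \in gball n2 -> inn m (a g z) -> hub z = g.
Proof.
move=> gB ig; rewrite /hub filter_cat; set s := [seq _ <- enum_fset (gball n2) | _].
have : g \in s by rewrite mem_filter ig.
have : all (fun g => inn m (a g z)) s by exact: filter_all.
have : {subset s <= gball n2} by move=> h; rewrite mem_filter => /andP[].
case: s => // h s sB /= /andP[ih _] _.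
have hB : h \in gball n2 by apply: sB; exact: mem_head.
have := @inn_sep (a g z) (h * g^-1)%g ig; rewrite -aM mulgVK => /(_ ih) e.
apply/esym/eqP; rewrite eq_sym -divg_eq1; apply/eqP/e.
by rewrite mul2n -addnn gball_mul // gball_inv.
Qed.

Lemma owner_gball z : (c z < m)%N -> owner z \in gball n1.
Proof. by move=> /ownerP[j [_ /and5P[]]]. Qed.

Lemma owner_color z : (c z < m)%N -> (c (a (owner z) z) < m)%N.
Proof. by move=> /ownerP[j [jm /and5P[_ /eqP ->]]]. Qed.

Lemma center_gball z : (c z < m)%N -> center z \in gball (2 * n2 + n1).
Proof.
move=> cz; have [hB _] := hubP (owner_color cz).
by rewrite gball_mul // owner_gball.
Qed.

Lemma center_inn z : (c z < m)%N -> inn m (a (center z) z).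
Proof. by move=> cz; rewrite /center aM; have [] := hubP (owner_color cz). Qed.

(* [bdry g j z]: [z] lies just outside the gball carved at stage [j] around
   [a g z], in the region not yet carved at that stage. *)
Definition bdry g j z := [&& (g^-1)%g \in gball (rho (rem j) (a g z)).+1,
  (g^-1)%g \notin gball (rho (rem j) (a g z)), c (a g z) == j, rem j (a g z) & rem j z].

(** Carved no earlier than [z], the point [a s z] still remains at stage [j]. It lies in the ball
    around [a g z], and then has the same owner, or just outside. *)
Lemma owner_step g j h k s z : s \in Sg -> (k < m)%N -> (j <= k)%N ->
  own g j z -> own h k (a s z) -> h = (g * s^-1)%g \/ bdry (g * s^-1)%g j (a s z).
Proof.
move=> sS km jk og oh; case/and5P: (og) => gB /eqP cg rz rg gr.
case/and5P: (oh) => hB _ rsz _ _.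
have e : a (g * s^-1)%g (a s z) = a g z by rewrite -aM mulgVK.
have rj : rem j (a s z) by exact: rem_le jk rsz.
have sg : ((g * s^-1)^-1)%g \in gball (rho (rem j) (a g z)).+1.
  by rewrite invgM invgK -addn1 addnC gball_mul // gball_gen.
have [inr|notr] := boolP (((g * s^-1)^-1)%g \in gball (rho (rem j) (a g z))).
  left; suff os : own (g * s^-1)%g j (a s z).
    by have [] := own_uniq km (leq_ltn_trans jk km) oh os.
  have gsB : (g * s^-1)%g \in gball n1.
    rewrite -[(g * s^-1)%g]invgK; apply: gball_inv => //.
    by apply: gball_le inr => //; exact: rho_le.
  by rewrite /own e cg eqxx rj rg inr gsB.
by right; rewrite /bdry e sg notr cg eqxx rg rj.
Qed.

(** The cell of [t] read in the group: the positions [g] whose center, as seen from [a g t], is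
    [t]. *)
Definition shape t : {fset G} :=
  [fset g in gball (2 * n2 + n1) | center (a g t) == (g^-1)%g]%fset.

Definition core (D : {fset G}) : {fset G} :=
  [fset g in D | all (fun s => (s * g)%g \in D) (enum_fset Sg)]%fset.

(** The owner of a point within distance [n2 - n1] of [t] is within distance [n2], and there the hub
    is [t]. *)
Lemma gball_sub_shape t : inn m t ->
  (forall g, g \in gball (2 * n2 + n1) -> (c (a g t) < m)%N) ->
  (gball (n2 - n1) `<=` shape t)%fset.
Proof.
move=> it ct; apply/fsubsetP => g gB; rewrite in_fset_sep; apply/andP; split.
  by apply: gball_le gB => //; lia.
have cg : (c (a g t) < m)%N by apply: ct; apply: gball_le gB => //; lia.
rewrite /center; set v := a (owner _) _.
rewrite (@hub_near v ((owner (a g t) * g)^-1)%g); first by rewrite invgM mulgVK.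
- apply: gball_inv => //; have -> : n2 = (n1 + (n2 - n1))%N by move: n12; lia.
  by rewrite gball_mul // owner_gball.
- have -> : v = a (owner (a g t) * g)%g t by rewrite /v aM.
  by rewrite actK.
Qed.

Lemma shape_core_owner t : inn m t ->
  (forall g, g \in gball (2 * n2 + n1).+1 -> (c (a g t) < m)%N) ->
  forall g, g \in shape t -> g \notin core (shape t) ->
  exists2 s, s \in Sg & (owner (a (s * g)%g t) * s)%g != owner (a g t).
Proof.
move=> it ct g gD; rewrite in_fset_sep gD /= => /allPn[s sS sgD].
exists s => //; apply: contra sgD => /eqP os.
move: gD; rewrite !in_fset_sep => /andP[gB /eqP cg].
have csg : center (a (s * g)%g t) = ((s * g)^-1)%g.
  have o' : owner (a (s * g)%g t) = (owner (a g t) * s^-1)%g by rewrite -os mulgK.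
  have v' : a (owner (a (s * g)%g t)) (a (s * g)%g t) = a (owner (a g t)) (a g t).
    by rewrite o' -[RHS]aM -aM mulgA mulgVK.
  by rewrite /center v' o' invgM -cg /center mulgA.
rewrite csg eqxx andbT -[(s * g)%g]invgK; apply: gball_inv => //.
rewrite -csg; apply: center_gball; apply: ct.
by rewrite -addn1 addnC gball_mul // gball_gen.
Qed.

(** Of two neighbors with different owners, the one carved no earlier borders the ball that carved
    the other. This is [a s z] or [z] itself, hence [s'] is [s] or 1. *)
Lemma owner_boundary z s : s \in Sg -> (c z < m)%N -> (c (a s z) < m)%N ->
  (owner (a s z) * s)%g != owner z ->
  exists s' w j, [/\ s' \in Sg, (j < m)%N & bdry w j (a s' z)].
Proof.
move=> sS cz csz; have [j [jm oj]] := ownerP cz; have [k [km ok]] := ownerP csz.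
move=> neq; have [jk|kj] := leqP j k.
  have [e|b] := owner_step sS km jk oj ok; first by rewrite e mulgVK eqxx in neq.
  by exists s, (owner z * s^-1)%g, j.
have [|e|b] := @owner_step _ k (owner z) j (s^-1)%g _ (SgV sS) jm (ltnW kj) ok.
- by rewrite actK.
- by rewrite e invgK eqxx in neq.
- exists 1%g, (owner (a s z) * s)%g, k; split=> //; rewrite a1.
  by rewrite actK invgK in b.
Qed.

Hypothesis e1_gt0 : (0 < e1)%R.
Hypothesis n1_big : ((#|` gball n1|)%:R < (1 + e1) ^+ n1)%R.

(** Otherwise the relative balls, starting from the point [v] itself, would grow by more than
    [1 + e1] at each of [n1] steps and outgrow [gball n1]. *)
Lemma rho_found (P : X -> bool) v : P v -> (rho P v < n1)%N /\
  ((cnt P (rho P v).+1 v)%:R <= (1 + e1) * (cnt P (rho P v) v)%:R)%R.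
Proof.
move=> Pv; rewrite /rho; set p := fun i => _.
have hp : has p (iota 0 n1).
  apply: contraT => /hasPn np.
  have gr i : (i <= n1)%N -> ((1 + e1) ^+ i <= (cnt P i v)%:R)%R.
    elim: i => [|i IH] i1.
      rewrite expr0 ler1n /cnt cardfs_gt0; apply/fset0Pn; exists 1%g.
      by rewrite in_fset_sep; apply/andP; split; [exact: fset11|rewrite a1].
    have := np i; rewrite mem_iota add0n /= i1 => /(_ isT).
    rewrite /p -ltNge => /ltW; apply: le_trans.
    by rewrite exprS ler_wpM2l ?IH 1?ltnW // addr_ge0 // ltW.
  have := lt_le_trans n1_big (gr _ (leqnn _)).
  rewrite ltr_nat ltnNge /cnt => /negP[]; apply: fsubset_leq_card.
  by apply/fsubsetP => g; rewrite in_fset_sep => /andP[].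
have fn : (find p (iota 0 n1) < n1)%N by move: hp; rewrite has_find size_iota.
by split=> //; have := nth_find 0 hp; rewrite nth_iota ?add0n.
Qed.

(** Each boundary point is charged to the center [w] of the ball it borders. [C w] is the ball
    carved by [w] and [C' w] the shell around it, of proportion at most [e1] by the choice of [rho];
    the carved balls are disjoint by [own_uniq]. *)
Lemma card_boundary t N :
  (#|` [fset g in gball N | has (fun j => has (fun w => bdry w j (a g t))
     (enum_fset (gball n1))) (iota 0 m)]%fset|%:R
   <= e1 * #|` gball (N + 2 * n1)|%:R)%R.
Proof.
pose W := [fset w in gball (N + n1) | (c (a w t) < m)%N && rem (c (a w t)) (a w t)]%fset.
pose P w := rem (c (a w t)).
pose rh w := rho (P w) (a w t).
pose C w := [fset (u * w)%g | u in [fset u in gball (rh w) | P w (a u (a w t))]]%fset.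
pose C' w := [fset (u * w)%g | u in [fset u in gball (rh w).+1 `\` gball (rh w) |
   P w (a u (a w t))]]%fset.
have cC w : #|` C w| = cnt (P w) (rh w) (a w t).
  by rewrite card_fset_image //; exact: mulIg.
have cC' w : (#|` C' w| = cnt (P w) (rh w).+1 (a w t) - cnt (P w) (rh w) (a w t))%N.
  rewrite card_fset_image; last exact: mulIg.
  rewrite /cnt -cardfsDS; last first.
    apply/fsubsetP => u; rewrite !in_fset_sep => /andP[uB ->]; rewrite andbT.
    exact: gball_le uB.
  congr #|` _|; apply/fsetP => u; rewrite in_fsetD !in_fset_sep in_fsetD.
  by case: (u \in _); case: (u \in _); case: (P _ _).
have wW w : w \in W -> (#|` C' w|%:R <= e1 * #|` C w|%:R)%R.
  rewrite in_fset_sep => /andP[wB /andP[cw rw]]; rewrite cC cC' -/(P w) in rw *.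
  have [_ le] := rho_found rw; rewrite natrB; last first.
    apply: fsubset_leq_card; apply/fsubsetP => u; rewrite !in_fset_sep => /andP[uB ->].
    by rewrite andbT; exact: gball_le uB.
  by rewrite lerBlDr; move: le; rewrite mulrDl mul1r addrC.
apply: (@le_trans _ _ (\sum_(w <- enum_fset W) #|` C' w|)%:R%R).
  rewrite ler_nat; apply: card_le_sum_cover => g.
  rewrite in_fset_sep => /andP[gB /hasP[j]]; rewrite mem_iota add0n /= => jm.
  case/hasP=> w wB /and5P[b1 b2 /eqP b3 b4 b5]; exists (w * g)%g.
    rewrite in_fset_sep aM b3 jm b4 !andbT addnC.
    by rewrite gball_mul.
  apply/imfsetP; exists (w^-1)%g; last by rewrite mulKg.
  by rewrite /= in_fset_sep in_fsetD /rh /P aM b3 b1 b2 actK b5.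
apply: (@le_trans _ _ (e1 * (\sum_(w <- enum_fset W) #|` C w|)%:R)%R).
  rewrite !natr_sum mulr_sumr; rewrite big_seq [leRHS]big_seq.
  by apply: ler_sum => w; exact: wW.
apply: ler_wpM2l; first exact: ltW.
rewrite ler_nat; apply: sum_card_disjoint => [w|w w' z].
  rewrite in_fset_sep => /andP[wB /andP[cw rw]]; apply/fsubsetP => z /imfsetP[u /=].
  rewrite in_fset_sep => /andP[uB _] ->; have [rn _] := rho_found rw.
  have -> : (N + 2 * n1 = n1 + (N + n1))%N by lia.
  by rewrite gball_mul //; apply: gball_le uB => //; exact: ltnW.
have own_C x y : x \in W -> y \in C x ->
    own (x * y^-1)%g (c (a x t)) (a y t) /\ (c (a x t) < m)%N.
  rewrite in_fset_sep => /andP[xB /andP[cx rx]] /imfsetP[u /=].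
  rewrite in_fset_sep => /andP[uB ux] ->; have [rn _] := rho_found rx.
  split=> //; rewrite invgM mulVKg aM; rewrite /rh /P in ux uB.
  rewrite /own actK eqxx rx invgK uB ux !andbT; apply: gball_inv => //.
  by apply: gball_le uB => //; exact: ltnW.
move=> wW1 wW2 /(own_C _ _ wW1)[hw1 c1] /(own_C _ _ wW2)[hw2 c2].
by have [/mulIg] := own_uniq c1 c2 hw1 hw2.
Qed.

(** Every point of the cell outside the core has a boundary point among its [Sg]-translates, so each
    boundary point is charged at most once for each element of [Sg]. *)
Lemma shape_invariant t : inn m t ->
  (forall g, g \in gball (2 * n2 + n1).+1 -> (c (a g t) < m)%N) ->
  (#|` shape t `\` core (shape t)|%fset%:R
    <= #|` Sg|%:R * (e1 * #|` gball (4 * n2)|%:R))%R.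
Proof.
move=> it ct; set N := (2 * n2 + n1)%N in ct *.
pose A := [fset g in gball N.+1 | has (fun j => has (fun w => bdry w j (a g t))
     (enum_fset (gball n1))) (iota 0 m)]%fset.
apply: (@le_trans _ _ (#|` Sg|%:R * #|` A|%:R)%R); last first.
  rewrite ler_wpM2l //; apply: le_trans (card_boundary _ _) _.
  apply: ler_wpM2l; first exact: ltW.
  rewrite ler_nat; apply/fsubset_leq_card/subset_gball => //.
  by move: n12; rewrite /N; lia.
rewrite -natrM ler_nat.
have -> : (#|` Sg| * #|` A| = \sum_(s <- enum_fset Sg) #|` [fset (s^-1 * g)%g | g in A]%fset|)%N.
  rewrite (eq_bigr (fun=> #|` A|)) => [|s _].
    by rewrite big_const_seq count_predT iter_addn_0 mulnC.
  by rewrite card_fset_image //; exact: mulgI.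
apply: card_le_sum_cover => g; rewrite in_fsetD => /andP[gnC gD].
have [s sS os] := shape_core_owner it ct gD gnC.
have gB : g \in gball N by move: gD; rewrite in_fset_sep => /andP[].
have c1 : (c (a g t) < m)%N by apply: ct; apply: gball_le gB.
have c2 : (c (a s (a g t)) < m)%N.
  by rewrite -aM; apply: ct; rewrite -addn1 addnC gball_mul // gball_gen.
rewrite aM in os; have [s' [w [j [s'S jm b]]]] := owner_boundary sS c1 c2 os.
exists s' => //; apply/imfsetP; exists (s' * g)%g; last by rewrite mulKg.
rewrite /= in_fset_sep; apply/andP; split.
  by rewrite -addn1 addnC gball_mul // gball_gen.
apply/hasP; exists j; rewrite ?mem_iota //; apply/hasP; exists w; last by rewrite aM.
case/and5P: b => b1 _ _ b4 _; have [rn _] := rho_found b4.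
by rewrite -[w]invgK; apply: gball_inv => //; exact: gball_le b1.
Qed.

(** The carving depends only on the pattern of colors in a bounded window. Such patterns are locally
    constant off the exceptional set, and this makes the bases of the towers open. *)
Definition sim N z z' := forall g, g \in gball N -> c (a g z) = c (a g z').

Lemma sim_le M N z z' : (M <= N)%N -> sim N z z' -> sim M z z'.
Proof. by move=> MN s g gB; apply: s; exact: gball_le gB. Qed.

Lemma sim_shift M N g z z' : g \in gball M -> sim (N + M) z z' ->
  sim N (a g z) (a g z').
Proof. by move=> gB s h hB; rewrite -!aM; apply: s; exact: gball_mul. Qed.

Lemma rho_local (P : X -> bool) M z z' :
  (forall w w', sim M w w' -> P w = P w') ->
  sim (M + n1) z z' -> rho P z = rho P z'.
Proof.
move=> PP s; have cc i : (i <= n1)%N -> cnt P i z = cnt P i z'.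
  move=> i1; congr #|` _|; apply/fsetP => g; rewrite !in_fset_sep.
  case: (boolP (g \in gball i)) => //= gB; apply: PP.
  by apply: sim_shift s; exact: gball_le gB.
apply: eq_in_find => i; rewrite mem_iota add0n /= => i1.
by rewrite !cc // ltnW.
Qed.

(** Each stage looks [n1] further for the centers and another [n1] for their radii. *)
Lemma rem_local j z z' : sim (j * (2 * n1)) z z' -> rem j z = rem j z'.
Proof.
elim: j z z' => // j IH z z' s /=; congr (_ && ~~ _).
  by apply: IH; apply: sim_le s; rewrite leq_mul2r leqnSn orbT.
apply: eq_in_has => g gB; congr [&& _, _ & _].
- by congr (_ == _); apply: s; apply: gball_le gB => //; nia.
- apply: IH; apply: sim_shift gB _; apply: sim_le s; nia.
- congr (_ \in gball _); apply: (rho_local IH); apply: sim_shift gB _.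
  by apply: sim_le s; nia.
Qed.

Lemma owner_local z z' : sim (m.+1 * (2 * n1)) z z' -> owner z = owner z'.
Proof.
move=> s; congr head; apply: eq_in_filter => g gB; apply: eq_in_has => j.
rewrite mem_iota add0n /= => jm; rewrite /own gB /=.
have jm' : (j * (2 * n1) + 2 * n1 <= m.+1 * (2 * n1))%N.
  by rewrite -mulSnr leq_mul2r ltnS ltnW ?orbT.
congr [&& _, _, _ & _].
- by congr (_ == _); apply: s; apply: gball_le gB => //; nia.
- by apply: rem_local; apply: sim_le s; lia.
- by apply: rem_local; apply: sim_shift gB _; apply: sim_le s; lia.
- congr (_ \in gball _); apply: (rho_local (@rem_local j)).
  by apply: sim_shift gB _; apply: sim_le s; lia.
Qed.

Lemma inn_local j z z' : sim (j * (2 * n2)) z z' -> inn j z = inn j z'.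
Proof.
elim: j z z' => // j IH z z' s /=; congr (_ || _ && ~~ _).
- by apply: IH; apply: sim_le s; rewrite leq_mul2r leqnSn orbT.
- by rewrite -[z]a1 -[z']a1; congr (_ == _); apply: s; exact: gball_one.
- apply: eq_in_has => g gB; apply: IH; apply: sim_shift gB _.
  by apply: sim_le s; rewrite [leqRHS]mulSnr.
Qed.

Lemma hub_local z z' : sim (m.+1 * (2 * n2)) z z' -> hub z = hub z'.
Proof.
move=> s; congr head; apply: eq_in_filter => g; rewrite mem_cat => gB.
have gB' : g \in gball (2 * n2).
  by case/orP: gB => // gB; apply: gball_le gB => //; lia.
by apply: inn_local; apply: sim_shift gB' _; apply: sim_le s; rewrite [leqRHS]mulSnr.
Qed.

(** The radius on which the hub depends, plus the distance to the owner, plus the radius on which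
    the owner depends. *)
Definition window := (m.+1 * (2 * n2) + n1 + m.+1 * (2 * n1))%N.

Lemma center_local z z' : (c z < m)%N -> sim window z z' -> center z = center z'.
Proof.
move=> cz s; have o : owner z = owner z'.
  by apply: owner_local; apply: sim_le s; rewrite leq_addl.
rewrite /center -o; congr (_ * _)%g; apply: hub_local.
apply: sim_shift (owner_gball cz) _; apply: sim_le s; exact: leq_addr.
Qed.

End Colored.
End Carving.

Local Open Scope classical_set_scope.
Local Open Scope ring_scope.

(** * Growth functions of polynomial order *)

Lemma leq_exp2l_weak m n k : (m <= n -> m ^ k <= n ^ k)%N.
Proof. by case: k => // k mn; rewrite leq_exp2r. Qed.

Section PolynomialGrowth.
Variables (b : nat -> nat) (kappa c : nat).
Hypothesis b_gt0 : forall n, (0 < b n)%N.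
Hypothesis b_le : forall n, (b n <= n.+1 ^ kappa * c)%N.

(** By Bernoulli's inequality [(1 + e) ^+ n.+1] is at least [n.+1%:R * e]. Its power [kappa.+1] has
    larger degree in [n] than the bound on [b] at [n.+1 * kappa.+1]. *)
Lemma exponential_beats (R : archiRealFieldType) (e : R) : 0 < e ->
  exists n, (b n)%:R < (1 + e) ^+ n.
Proof.
move=> e0; pose x : R := (kappa.+2 ^ kappa * c)%:R / e ^+ kappa.+1.
have [n xn] : exists n : nat, x < n.+1%:R.
  exists (Num.bound x); apply: lt_trans (archi_boundP _) _.
    by rewrite divr_ge0 // exprn_ge0 // ltW.
  by rewrite ltr_nat.
exists (n.+1 * kappa.+1)%N; rewrite exprM.
have bern : n.+1%:R * e <= (1 + e) ^+ n.+1.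
  have h (k : nat) : 1 + k%:R * e <= (1 + e) ^+ k.
    elim: k => [|k IH]; first by rewrite mul0r addr0 expr0.
    rewrite exprS -natr1; have k0 : 0 <= k%:R :> R by [].
    by have := mulr_ge0 k0 (mulr_ge0 (ltW e0) (ltW e0)); nra.
  by apply: le_trans (h _); rewrite lerDr.
have ne0 : 0 <= n.+1%:R * e by rewrite mulr_ge0 // ltW.
apply: lt_le_trans (_ : (n.+1%:R * e) ^+ kappa.+1 <= _); last first.
  by rewrite lerXn2r // nnegrE // exprn_ge0 // addr_ge0 // ltW.
rewrite exprMn; apply: le_lt_trans (_ : (n.+1 ^ kappa * (kappa.+2 ^ kappa * c))%:R < _).
  rewrite ler_nat; apply: leq_trans (b_le _) _; rewrite mulnA leq_mul2r -expnMn.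
  by rewrite leq_exp2l_weak ?orbT //; nia.
rewrite natrM exprSr -mulrA natrX ltr_pM2l ?exprn_gt0 //.
by move: xn; rewrite ltr_pdivrMr ?exprn_gt0 // mulrC.
Qed.

Lemma almost_invariant_step (R : archiRealFieldType) (e : R) : 0 < e ->
  exists n, (b n.+1)%:R <= (1 + e) * (b n)%:R.
Proof.
move=> e0; have [n bn] := exponential_beats e0.
have [/existsP[i bi]|] := boolP [exists i : 'I_n, (b i.+1)%:R <= (1 + e) * (b i)%:R].
  by exists i.
rewrite negb_exists => /forallP h.
have h2 i : (i <= n)%N -> (1 + e) ^+ i <= (b i)%:R.
  elim: i => [|i IH] iK; first by rewrite expr0 ler1n.
  have := h (Ordinal iK); rewrite -ltNge /= => /ltW; apply: le_trans.
  by rewrite exprS ler_wpM2l ?IH 1?ltnW // addr_ge0 // ltW.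
by have := lt_le_trans bn (h2 n (leqnn n)); rewrite ltxx.
Qed.

Lemma doubling : exists C, forall N, exists k, (N <= k)%N /\ (b (8 * k) <= C * b k)%N.
Proof.
(* [K] is both the number of scales [8 ^ i * N1] that are tried and the constant of the polynomial
   bound on them: failure at every scale would give [2 ^ K <= K]. *)
exists (2 * 8 ^ kappa)%N => N; pose N1 := N.+1; pose K := ((2 * N1) ^ kappa * c)%N.
have [/existsP[i bi]|] := boolP [exists i : 'I_K,
    b (8 * (8 ^ i * N1)) <= 2 * 8 ^ kappa * b (8 ^ i * N1)]%N.
  exists (8 ^ i * N1)%N; split=> //; apply: leq_trans (leqnSn N) _.
  by rewrite leq_pmull // expn_gt0.
rewrite negb_exists => /forallP h.
have h2 i : (i <= K)%N -> ((2 * 8 ^ kappa) ^ i <= b (8 ^ i * N1))%N.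
  elim: i => [|i IH] iK; first by rewrite expn0 mul1n.
  have := h (Ordinal iK); rewrite -ltnNge /= => /ltnW; rewrite mulnA -expnS.
  by apply: leq_trans; rewrite expnS leq_mul2l IH ?orbT // ltnW.
have := leq_trans (h2 K (leqnn K)) (b_le _).
have grow j : ((8 ^ j * N1).+1 ^ kappa * c <= 8 ^ (j * kappa) * K)%N.
  rewrite /K mulnA leq_mul2r expnM -expnMn.
  have -> // : ((8 ^ j * N1).+1 ^ kappa <= (8 ^ j * (2 * N1)) ^ kappa)%N; last exact: orbT.
  have : (0 < 8 ^ j * N1)%N by rewrite muln_gt0 expn_gt0.
  move=> ?; apply: leq_exp2l_weak; lia.
move=> h4; have := leq_trans h4 (grow K).
rewrite expnMn -expnM (mulnC kappa) mulnC leq_pmul2l ?expn_gt0 //.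
by rewrite leqNgt ltn_expl.
Qed.
End PolynomialGrowth.

(** * Subequivalence *)

Lemma compact_finite_subcover (X : topologicalType) (I : choiceType) (f : I -> set X) :
  compact [set: X] -> (forall i, open (f i)) -> (forall x, exists i, f i x) ->
  exists s : seq I, forall x, exists2 i, i \in s & f i x.
Proof.
move=> cX fo fc; have [[x0 _]|X0] := pselect (exists x : X, True); last first.
  by exists [::] => x; case: X0; exists x.
have cX0 : @compact (pointed_at x0) setT by exact: cX.
rewrite compact_cover in cX0; have [|x _|D _ DX] := cX0 I setT f; first by move=> i _; exact: fo.
  by have [i fi] := fc x; exists i.
by exists (enum_fset D) => x; have [i iD fi] := DX x Logic.I; exists i.
Qed.

(** The distance to the complement of [U], or the constant 1 if the complement is empty. *)
Lemma open_positive_function (R : realType) (X : topologicalType) (U : set X) :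
  metrizable R X -> open U ->
  exists phi : X -> R, [/\ continuous phi, forall x, 0 <= phi x &
    forall x, (0 < phi x) <-> U x].
Proof.
case=> M [f [h [fK hK fc hc]]] Uo.
pose C := [set m : M | ~ U (h m)].
have [C0|/set0P[c Cc]] := eqVneq C set0.
  exists (fun=> 1); split=> [|//|x]; first exact: cst_continuous.
  split=> // _; apply: contrapT => nU.
  have : C (f x) by rewrite /C/= fK.
  by rewrite C0.
pose d m : R := inf [set mdist m y | y in C].
have hi m : has_inf [set mdist m y | y in C].
  split; first by exists (mdist m c), c.
  by exists 0 => _ [y _ <-]; exact: mdist_ge0.
have dle m y : C y -> d m <= mdist m y.
  by move=> Cy; apply: ge_inf; [have [] := hi m|exists y].
have dge m e : (forall y, C y -> e <= mdist m y) -> e <= d m.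
  move=> h'; apply: lb_le_inf; first by exists (mdist m c), c.
  by move=> _ [y Cy <-]; exact: h'.
have dlip m m' : d m <= mdist m m' + d m'.
  rewrite -lerBlDl; apply: dge => y Cy; rewrite lerBlDl.
  by apply: le_trans (metric_triangle _ m' _); exact: dle.
have dc : continuous d.
  move=> m; apply/cvgrPdist_lt => e e0; near=> m'.
  have mm' : mdist m m' < e.
    near: m'; have := nbhsx_ballx m _ e0; apply: filterS => y.
    by rewrite ballEmdist.
  rewrite ltr_norml; have := dlip m m'; have := dlip m' m.
  by rewrite (metric_sym m' m); lra.
have d0 m : 0 <= d m by apply: dge => y _; exact: mdist_ge0.
exists (d \o f); split=> [x|x|x]; first 2 [exact: d0].
  by apply: continuous_comp; [exact: fc|exact: dc].
split=> [dx|Ux]; last first.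
  have : nbhs (f x) (h @^-1` U).
    by apply: hc; rewrite fK; exact: open_nbhs_nbhs.
  rewrite -nbhs_ballE => -[e /= e0 eU]; apply: lt_le_trans e0 _.
  apply: dge => y Cy; rewrite leNgt; apply/negP => ye.
  by apply: Cy; apply: eU; rewrite ballEmdist.
apply: contrapT => nU; move: dx; rewrite ltNge => /negP; apply.
have := @dle (f x) (f x); rewrite mdistxx; apply.
by rewrite /C /= fK.
Unshelve. all: by end_near. Qed.

Section Subequivalence.
Variables (G : groupType) (X : topologicalType) (a : G -> X -> X).
Hypothesis ha : acts_by_homeomorphisms a.

Lemma act1 x : a 1%g x = x. Proof. by case: ha => -[]. Qed.
Lemma actM g h x : a (g * h)%g x = a g (a h x). Proof. by case: ha => -[]. Qed.
Lemma act_continuous g : continuous (a g). Proof. by case: ha. Qed.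
Lemma act_mulK g x : a g^-1 (a g x) = x. Proof. exact: actK act1 actM g x. Qed.
Lemma act_mulKV g x : a g (a g^-1 x) = x. Proof. exact: actKV act1 actM g x. Qed.

Lemma act_image g (O : set X) : a g @` O = a g^-1 @^-1` O.
Proof.
apply/seteqP; split=> [_ [x Ox <-]|x Ox] /=; first by rewrite act_mulK.
by exists (a g^-1 x) => //; rewrite act_mulKV.
Qed.

Lemma open_preimage_act g (O : set X) : open O -> open (a g @^-1` O).
Proof. by move=> Oo; apply: open_comp => // x _; exact: act_continuous. Qed.

Lemma open_image_act g (O : set X) : open O -> open (a g @` O).
Proof. by move=> Oo; rewrite act_image; exact: open_preimage_act. Qed.

Lemma subequivalentI (J : finType) (O : J -> set X) (g : J -> G) (A B : set X) :
  (forall j, open (O j)) ->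
  (forall x, A x -> exists j, O j x) ->
  (forall i j x y, O i x -> O j y -> a (g i) x = a (g j) y -> i = j) ->
  (forall j x, O j x -> B (a (g j) x)) ->
  is_subequivalent a A B.
Proof.
move=> Oo AO dis OB; exists #|J|, (O \o enum_val), (g \o enum_val); split=> /=.
- by move=> j; exact: Oo.
- by move=> x /AO[j Ojx]; exists (enum_rank j) => //=; rewrite enum_rankK.
- move=> i j _ _ [_ [[x Ox <-] [y Oy]]] e.
  by apply: enum_val_inj; rewrite (dis _ _ _ _ Oy Ox e).
- by move=> j _ [x Ox <-]; exact: OB.
Qed.

Lemma subequivalentE (A B : set X) : is_subequivalent a A B ->
  exists n (O : 'I_n -> set X) (g : 'I_n -> G), [/\ forall j, open (O j),
    forall x, A x -> exists j, O j x,
    forall i j x y, O i x -> O j y -> a (g i) x = a (g j) y -> i = j &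
    forall j x, O j x -> B (a (g j) x)].
Proof.
case=> n [V [g [Oo AO dis OB]]]; exists n, V, g; split=> //.
- by move=> x /AO[j _ Oj]; exists j.
- move=> i j x y Ox Oy e; apply: dis => //; exists (a (g i) x).
  by split; [exists x | rewrite e; exists y].
- by move=> j x Ox; apply: (OB j); exists x.
Qed.

Lemma subequivalent_sub (A A' B B' : set X) : A' `<=` A -> B `<=` B' ->
  is_subequivalent a A B -> is_subequivalent a A' B'.
Proof.
move=> AA BB /subequivalentE[n [V [g [Oo AO dis OB]]]].
apply: (@subequivalentI _ V g) => //; first by move=> x /AA /AO.
by move=> j x /OB /BB.
Qed.

Lemma subequivalent_trans (A B C : set X) :
  is_subequivalent a A B -> is_subequivalent a B C -> is_subequivalent a A C.
Proof.
move=> /subequivalentE[n [V [g [Oo AO dis OB]]]].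
move=> /subequivalentE[m [P [h [Po BP disP PC]]]].
apply: (@subequivalentI ('I_n * 'I_m)%type
  (fun u => V u.1 `&` a (g u.1) @^-1` P u.2) (fun u => (h u.2 * g u.1)%g)).
- by move=> u; apply: openI => //; exact: open_preimage_act.
- move=> x Ax; have [j Oj] := AO x Ax; have [k Pk] := BP _ (OB _ _ Oj).
  by exists (j, k).
- move=> [i i'] [j j'] x y /= [Ox Px] [Oy Py]; rewrite !actM => e.
  have e' := disP _ _ _ _ Px Py e; rewrite -e' in e *.
  have {}e : a (g i) x = a (g j) y by rewrite -(act_mulK (h i') (a (g i) x)) e act_mulK.
  by rewrite (dis _ _ _ _ Ox Oy e).
- by move=> [i j] x /= [_ Px]; rewrite actM; exact: PC.
Qed.

Lemma subequivalentU (A1 A2 B1 B2 : set X) : (forall x, B1 x -> ~ B2 x) ->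
  is_subequivalent a A1 B1 -> is_subequivalent a A2 B2 ->
  is_subequivalent a (A1 `|` A2) (B1 `|` B2).
Proof.
move=> B12 /subequivalentE[n [V [g [Oo AO dis OB]]]].
move=> /subequivalentE[m [P [h [Po BP disP PC]]]].
apply: (@subequivalentI ('I_n + 'I_m)%type
  (fun u => match u with inl i => V i | inr j => P j end)
  (fun u => match u with inl i => g i | inr j => h j end)).
- by case.
- by move=> x [/AO[j Oj]|/BP[j Pj]]; [exists (inl j) | exists (inr j)].
- move=> [i|i] [j|j] x y Hx Hy e.
  + by rewrite (dis _ _ _ _ Hx Hy e).
  + by have := B12 _ (OB _ _ Hx); rewrite e => /(_ (PC _ _ Hy)).
  + by have := B12 _ (OB _ _ Hy); rewrite -e => /(_ (PC _ _ Hx)).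
  + by rewrite (disP _ _ _ _ Hx Hy e).
- by move=> [j|j] x Hx; [left; exact: OB|right; exact: PC].
Qed.

Lemma subequivalent_act g (A B : set X) : is_subequivalent a A B ->
  is_subequivalent a (a g @^-1` A) B.
Proof.
move=> /subequivalentE[n [V [h [Oo AO dis OB]]]].
apply: (@subequivalentI _ (fun i => a g @^-1` V i) (fun i => (h i * g)%g)).
- by move=> j; exact: open_preimage_act.
- by move=> x /AO.
- by move=> i j x y /= Ox Oy; rewrite !actM; exact: dis.
- by move=> j x Ox; rewrite actM; exact: OB.
Qed.

(** A cover by [k] sets, each subequivalent to [U] on its own: their images in [U] may overlap, so
    putting them side by side takes [k] disjoint copies of [U]. *)
Fixpoint small (U : set X) (k : nat) (R : set X) : Prop :=
  if k is k'.+1 then exists R1 R2, [/\ R `<=` R1 `|` R2, is_subequivalent a R1 U &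
    small U k' R2]
  else R `<=` set0.

Lemma small_sub U k (R R' : set X) : R' `<=` R -> small U k R -> small U k R'.
Proof.
case: k => [|k] RR /=; first by move/(subset_trans RR).
by case=> R1 [R2 [h1 h2 h3]]; exists R1, R2; split=> //; exact: subset_trans h1.
Qed.

Lemma smallU U k l (R R' : set X) : small U k R -> small U l R' ->
  small U (k + l) (R `|` R').
Proof.
elim: k R => [|k IH] R /= sR sR'.
  by apply: small_sub sR' => x [/sR|].
case: sR => R1 [R2 [h1 h2 h3]]; exists R1, (R2 `|` R'); split=> //; last exact: IH.
by move=> x [/h1[]|]; [left|right; left|right; right].
Qed.

Lemma small_act g U k (R : set X) : small U k R -> small U k (a g @^-1` R).
Proof.
elim: k R => [|k IH] R /=; first by move=> h x /= /h.
case=> R1 [R2 [h1 h2 h3]]; exists (a g @^-1` R1), (a g @^-1` R2); split.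
- by move=> x /= /h1.
- exact: subequivalent_act.
- exact: IH.
Qed.

Lemma small_window (W : seq G) U k (R : set X) : small U k R ->
  small U (size W * k) [set x | exists2 g, g \in W & R (a g x)].
Proof.
move=> sR; elim: W => [|g W IH]; first by move=> x [].
rewrite mulSn; apply: small_sub (smallU (small_act g sR) IH).
move=> x [h]; rewrite inE => /orP[/eqP ->|hW Rh]; first by left.
by right; exists h.
Qed.

End Subequivalence.

(** * Colorings from markers *)

Section LineMIS.
Local Open Scope nat_scope.
Implicit Types q : nat -> nat -> bool.

(* The greedy maximal independent set of the half-line, when [q k i] says that
   the site [k] may be chosen at stage [i]. *)
Fixpoint line_mis q i k : bool :=
  if i is j.+1 then
    line_mis q j k || [&& q k j, ~~ line_mis q j k.-1 & ~~ line_mis q j k.+1]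
  else false.

Lemma line_mis_le q i j k : i <= j -> line_mis q i k -> line_mis q j k.
Proof.
move=> ij; elim: j ij => [|j IH]; first by rewrite leqn0 => /eqP ->.
by rewrite leq_eqVlt => /orP[/eqP -> //|]; rewrite ltnS => /IH h /= /h ->.
Qed.

Lemma line_mis_indep q : (forall k i, ~~ (q k i && q k.+1 i)) ->
  forall i k, ~~ (line_mis q i k && line_mis q i k.+1).
Proof.
move=> qq; elim=> [//|i IH] k /=; have := IH k; have := qq k i.
have := IH k.+1; rewrite /=.
by do 6 case: (line_mis _ _ _) => //=; case: (q k i) => //=; case: (q k.+1 i).
Qed.

Lemma line_mis_maximal q r i k : i < r -> q k i ->
  [|| line_mis q r k, line_mis q r k.-1 | line_mis q r k.+1].
Proof.
move=> ir qk; have [h|] := boolP [|| line_mis q i k.-1 | line_mis q i k.+1].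
  by case/orP: h => /(line_mis_le (ltnW ir)) ->; rewrite !orbT.
rewrite negb_or => /andP[h1 h2].
by rewrite (line_mis_le ir) //= qk h1 h2 orbT.
Qed.

(** After [i] stages a site depends only on the sites within distance [i]. The bound [i <= k] keeps
    these away from the end of the half-line, where [0.-1 = 0] breaks the shift. *)
Lemma line_mis_shift q q' d i k :
  (forall l j, l <= k + i -> k <= l + i -> j < i -> q' l j = q (l + d) j) ->
  i <= k -> line_mis q' i k = line_mis q i (k + d).
Proof.
elim: i k => //= i IH k qq ik.
rewrite !IH; try lia; last 3 first.
- by move=> l j *; apply: qq; lia.
- by move=> l j *; apply: qq; lia.
- by move=> l j *; apply: qq; lia.
rewrite qq; try lia.
by have -> : (k.-1 + d = (k + d).-1) by lia.
Qed.
End LineMIS.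

Section Coloring.
Variables (R : realType) (G : groupType) (X : topologicalType) (a : G -> X -> X).
Hypothesis ha : acts_by_homeomorphisms a.

Lemma marker_cover (phi : X -> R) : compact [set: X] -> continuous phi ->
  (forall x, exists g, 0 < phi (a g x)) ->
  exists (c : R) (F : seq G), 0 < c /\ forall x, exists2 g, g \in F & c < phi (a g x).
Proof.
move=> cX cphi GU.
have [|x|s sX] := @compact_finite_subcover X (G * nat)%type
    (fun u => [set x | u.2.+1%:R^-1 < phi (a u.1 x)]) cX.
- move=> [g n] /=; rewrite (_ : mkset _ = (phi \o a g) @^-1` [set y | n.+1%:R^-1 < y]) //.
  apply: open_comp; last exact: open_gt.
  by move=> x _; apply: continuous_comp; [exact: act_continuous|exact: cphi].
- have [g g0] := GU x; exists (g, Num.bound (phi (a g x))^-1) => /=.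
  rewrite invf_plt ?posrE //; apply: lt_trans (archi_boundP _) _.
    by rewrite invr_ge0 ltW.
  by rewrite ltr_nat.
exists (\max_(u <- s) u.2).+1%:R^-1, (map fst s); split; first by rewrite invr_gt0.
move=> x; have [u us ux] := sX x; exists u.1; first exact: map_f.
apply: le_lt_trans ux; rewrite lef_pV2 ?posrE // ler_nat ltnS.
exact: (@leq_bigmax_seq _ _ xpredT (fun u => u.2)).
Qed.

Definition locally_constant_off (T : Type) (Rs : set X) (c : X -> T) :=
  forall x, ~ Rs x -> \forall y \near x, c y = c x.

(** On the line [x, g x, g ^ 2 x, ...] the site [k] may be chosen at stage [i] if [phi], at its
    translate by [f i], exceeds [tau (i * K + k)]. Passing from [x] to [a g x] renumbers the sites
    and lowers each threshold by one step. This changes a test only if some value lies between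
    consecutive thresholds, and [Rs] collects the [x] where this happens. Off [Rs] the two
    independent sets agree up to a shift; the color tells whether the site [m], else the site
    [m - 1], is chosen. *)
Lemma three_coloring (g : G) (phi : X -> R) : compact [set: X] -> continuous phi ->
  (forall x, exists h, 0 < phi (a h x)) ->
  (forall h x, 0 < phi x -> phi (a (g ^ h)%g x) <= 0) ->
  exists (c : X -> nat) (Rs : set X), [/\ closed Rs, small a [set x | 0 < phi x] 2 Rs,
    locally_constant_off Rs c, forall x, (c x < 3)%N &
    forall x, ~ Rs x -> c (a g x) <> c x].
Proof.
move=> cX cphi GU Ufree; have [c0 [F [c0_gt0 FX]]] := marker_cover cX cphi GU.
pose r := size F; pose f i := nth 1%g F i.
(* The independent set has [r] stages, so a site depends on those within distance [r]. [K] leaves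
   room for this around the sites [m - 1], [m] and [m + 1], where [m = r + 2]. *)
pose K := (2 * r + 6)%N; pose N := (r * K)%N.
pose tau p : R := c0 * p.+1%:R / N.+1%:R.
pose val p x := phi (a (f (p %/ K)%N * g ^+ ((p %% K)%N.+1))%g x).
pose q x k i := tau (i * K + k)%N < phi (a (f i * g ^+ k)%g x).
pose Rs := [set x | exists2 p, (p < N)%N & tau p <= val p x <= tau p.+1].
have N0 : 0 < N.+1%:R :> R by [].
have tau_lt p p' : (tau p < tau p') = (p < p')%N.
  by rewrite /tau ltr_pM2r ?invr_gt0 // ltr_pM2l // ltr_nat ltnS.
have tau_gt0 p : 0 < tau p by rewrite /tau divr_gt0 // mulr_gt0.
have tau_c0 p : (p < N)%N -> tau p < c0.
  by move=> pN; rewrite /tau ltr_pdivrMr // ltr_pM2l // ltr_nat ltnS.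
have cval p : continuous (val p).
  by move=> x; apply: continuous_comp; [exact: act_continuous|exact: cphi].
have Rs_closed : closed Rs.
  rewrite (_ : Rs = \bigcup_(p in `I_N) (val p @^-1` `[tau p, tau p.+1])).
    apply: closed_bigcup => [|p _]; first exact: finite_II.
    by apply: closed_comp => [x _|]; [exact: cval|exact: interval_closed].
  by apply/seteqP; split=> [x [p pN h]|x [p pN h]]; exists p.
have K0 : (0 < K)%N by rewrite /K; lia.
(* Consecutive sites differ, after translation by [f i], by a conjugate of [g], so [phi] is not
   positive at both. *)
have val_free x k i : 0 < phi (a (f i * g ^+ k)%g x) ->
    phi (a (f i * g ^+ k.+1)%g x) <= 0.
  move=> h; have := Ufree (f i)^-1%g _ h.
  rewrite -(actM ha) conjgE invgK expgS !mulgA; congr (phi (a _ x) <= 0).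
  by rewrite mulgVK.
have qfree x k i : ~~ (q x k i && q x k.+1 i).
  apply/negP => /andP[q1 q2]; have := val_free x k i (lt_trans (tau_gt0 _) q1).
  by rewrite leNgt (lt_trans (tau_gt0 _) q2).
have idx k i : (k < K)%N -> ((i * K + k) %/ K = i)%N /\ ((i * K + k) %% K = k)%N.
  by move=> kK; rewrite divnMDl // divn_small // addn0 modnMDl modn_small.
have idxN k i : (k < K)%N -> (i < r)%N -> (i * K + k < N)%N.
  move=> kK ir; apply: leq_trans (_ : i.+1 * K <= _)%N; first by rewrite mulSn; lia.
  by rewrite leq_mul2r ir orbT.
pose N_ x k := line_mis (q x) r k.
pose m := (r + 2)%N.
pose c x := if N_ x m then 0%N else if N_ x m.-1 then 1%N else 2%N.
have shift x k i : ~ Rs x -> (k.+1 < K)%N -> (i < r)%N -> q (a g x) k i = q x k.+1 i.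
  move=> nR kK ir; have [di mi] := idx k i (ltnW kK).
  have e : phi (a (f i * g ^+ k)%g (a g x)) = val (i * K + k)%N x.
    by rewrite /val di mi -(actM ha) -mulgA -expgSr.
  have e' : phi (a (f i * g ^+ k.+1)%g x) = val (i * K + k)%N x.
    by rewrite /val di mi.
  rewrite /q e e' addnS.
  have [h|h] := ltP (tau (i * K + k)%N) (val (i * K + k)%N x); last first.
    by apply/esym/negbTE; rewrite -leNgt (le_trans h) // ltW // tau_lt.
  apply/esym; rewrite ltNge; apply/negP => h'; apply: nR.
  by exists (i * K + k)%N; [apply: idxN => //; exact: ltnW|rewrite (ltW h) h'].
have shiftN x k : ~ Rs x -> (r <= k)%N -> (k + r + 1 < K)%N -> N_ (a g x) k = N_ x k.+1.
  move=> nR rk kK; rewrite /N_ (@line_mis_shift (q x) _ 1) ?addn1 // => l j h1 h2 jr.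
  by rewrite addn1; apply: shift => //; lia.
exists c, Rs; split=> //.
(* The bands of [Rs] are split by the parity of [p]. Bands of one parity belong to disjoint
   intervals of values of [phi], so moving each band by its own group element gives disjoint images
   in the marker. *)
- pose Rb (b : bool) := [set x | exists2 p, (p < N)%N & odd p = b /\ tau p <= val p x <= tau p.+1].
  have Rb_sub b : is_subequivalent a (Rb b) [set x | 0 < phi x].
    (* A third of the distance between thresholds: intervals enlarged by [d] are open, still
       disjoint for a fixed parity, and stay above 0. *)
    pose d := c0 / N.+1%:R / 3.
    have d0 : 0 < d by rewrite /d !divr_gt0.
    have tauE p : tau p = 3 * d * p.+1%:R.
      rewrite /tau /d; move: (N.+1%:R) N0 => n n0; field.
      by rewrite lt0r_neq0.
    apply: (@subequivalentI _ _ _ 'I_N (fun p => [set x | odd p = b /\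
       tau p - d < val p x < tau p.+1 + d])
       (fun p => (f (p %/ K)%N * g ^+ (p %% K)%N.+1)%g)).
    + move=> p; have [bb|bb] := eqVneq (odd p) b; last first.
        rewrite (_ : mkset _ = set0); first exact: open0.
        by apply/seteqP; split=> // x [bb']; rewrite bb' eqxx in bb.
      rewrite (_ : mkset _ = val p @^-1` `]tau p - d, tau p.+1 + d[).
        by apply: open_comp; [move=> x _; exact: cval|exact: interval_open].
      by apply/seteqP; split=> x /= => [[]|].
    + move=> x [p pN [bb /andP[h1 h2]]]; exists (Ordinal pN); split=> //=.
      by apply/andP; split; lra.
    + move=> p p' x y [b1 /andP[h1 h2]] [b2 /andP[h3 h4]] e.
      have ev : val p x = val p' y by rewrite /val e.
      rewrite -ev in h3 h4.
      have close (s t : nat) v : tau s - d < v -> v < tau t.+1 + d -> (s <= t.+1)%N.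
        rewrite !tauE => u1 u2; rewrite leqNgt; apply/negP => st.
        have : (t.+2%:R + 1 : R) <= s.+1%:R by rewrite natr1 ler_nat ltnS.
        by nra.
      have l1 := close _ _ _ h1 h4; have l2 := close _ _ _ h3 h2.
      apply: val_inj; move: b1; rewrite -b2 => oo /=.
      have [lt|lt|//] := ltngtP p p'.
        have e1 : nat_of_ord p' = p.+1 by apply/eqP; rewrite eqn_leq lt l2.
        by move: oo; rewrite e1 /=; case: (odd p).
      have e1 : nat_of_ord p = p'.+1 by apply/eqP; rewrite eqn_leq lt l1.
      by move: oo; rewrite e1 /=; case: (odd p').
    + move=> p x [_ /andP[h1 h2]]; apply: le_lt_trans h1.
      by rewrite tauE -natr1; have : 0 <= (p : nat)%:R :> R by []; nra.
  exists (Rb true), (Rb false); split=> //.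
    move=> x [p pN h]; case o : (odd p); [left|right]; exists p => //.
  by exists (Rb false), set0; split=> // x; left.
(* Off [Rs] no value at a site [k > 0] equals its threshold, so the tests there are locally
   constant. The site 0 is not reached, since [m - 1 > r]. *)
- move=> x nR; have qc k i : (0 < k < K)%N -> (i < r)%N ->
      \forall y \near x, q y k i = q x k i.
    case: k => // k kK ir.
    have [di mi] := idx k i (ltnW kK).
    have vE y : phi (a (f i * g ^+ k.+1)%g y) = val (i * K + k)%N y.
      by rewrite /val di mi.
    have nt : val (i * K + k)%N x != tau (i * K + k).+1.
      apply/eqP => e; apply: nR; exists (i * K + k)%N; first by apply: idxN => //; exact: ltnW.
      by rewrite e lexx andbT ltW // tau_lt.
    have cv : val (i * K + k)%N y @[y --> x] --> val (i * K + k)%N x by exact: cval.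
    have [lt|lt|e] := ltgtP (val (i * K + k)%N x) (tau (i * K + k).+1); last first.
    + by rewrite e eqxx in nt.
    + near=> y; rewrite /q !vE addnS lt; near: y.
      by apply: (cv [set v | tau (i * K + k).+1 < v]); exact: lt_nbhsr.
    + near=> y; rewrite /q !vE addnS (lt_gtF lt); apply/negbTE; rewrite -leNgt.
      apply: ltW; near: y.
      by apply: (cv [set v | v < tau (i * K + k).+1]); exact: lt_nbhsl.
  have qc' : \forall y \near x, forall u : 'I_K * 'I_r, (0 < u.1)%N ->
      q y u.1 u.2 = q x u.1 u.2.
    apply: filter_forall => -[k i] /=; case: (posnP k) => [->|k0].
      by near=> y.
    by apply: filterS (qc k i _ (ltn_ord i)) => //; rewrite k0 ltn_ord.
  apply: filterS qc' => y qy; rewrite /c /N_.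
  have NN k : (r < k)%N -> (k + r < K)%N -> line_mis (q y) r k = line_mis (q x) r k.
    move=> rk kK; rewrite (@line_mis_shift (q x) _ 0) ?addn0 //; last exact: ltnW.
    move=> l j h1 h2 jr; rewrite addn0.
    have lK : (l < K)%N by lia.
    by apply: (qy (Ordinal lK, Ordinal jr)) => /=; lia.
  by rewrite !NN /m /K; try lia.
- by move=> x; rewrite /c; case: ifP => // _; case: ifP.
- move=> x nR; have e1 : N_ (a g x) m = N_ x m.+1 by apply: shiftN => //; rewrite /m /K; lia.
  have e2 : N_ (a g x) m.-1 = N_ x m.
    have -> : m = m.-1.+1 by rewrite /m; lia.
    by apply: shiftN => //; rewrite /m /K; lia.
  have i1 := line_mis_indep (qfree x) r m.
  (* All thresholds are below [c0], so the site [m] passes the test at some stage; by maximality it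
     or a neighbor is chosen. *)
  have [h hF qh] := FX (a (g ^+ m)%g x).
  have ir : (index h F < r)%N by rewrite index_mem.
  have qm : q x m (index h F).
    rewrite /q (lt_trans (tau_c0 _ (idxN _ _ _ _))) //; first by rewrite /m /K; lia.
    by rewrite /f nth_index // (actM ha).
  have := line_mis_maximal ir qm; rewrite -/(N_ x m) -/(N_ x m.-1) -/(N_ x m.+1) in i1 *.
  rewrite /c e1 e2; move: i1.
  by case: (N_ x m); case: (N_ x m.-1); case: (N_ x m.+1).
Unshelve. all: by end_near. Qed.
End Coloring.

(** * Castles with small complement *)

(** Conjugacy classes are finite, so those of the elements of [K] and of their inverses can all be
    added. *)
Lemma FC_generators (G : groupType) (K : {fset G}) : FC_group G ->
  exists Sg : {fset G}, [/\ (K `<=` Sg)%fset, 1%g \in Sg,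
    forall s, s \in Sg -> (s^-1)%g \in Sg &
    forall s t, s \in Sg -> (s ^ t)%g \in Sg].
Proof.
move=> FC; pose cl x : {fset G} := fset_set [set conjg x y | y in [set: G]].
have clP x y : reflect (exists t, (x ^ t)%g = y) (y \in cl x).
  rewrite in_fset_set //; apply: (iffP idP); rewrite inE.
    by case=> t _ <-; exists t.
  by case=> t <-; exists t.
exists (1%g |` \bigcup_(x <- enum_fset K) (cl x `|` cl (x^-1)%g))%fset; split.
- apply/fsubsetP => x xK; rewrite in_fset1U; apply/orP; right.
  apply/bigfcupP; exists x; rewrite ?xK // in_fsetU; apply/orP; left.
  by apply/clP; exists 1%g; rewrite conjg1.
- by rewrite in_fset1U eqxx.
- move=> s; rewrite !in_fset1U => /orP[/eqP ->|/bigfcupP[x]].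
    by rewrite invg1 eqxx.
  rewrite andbT => xK; rewrite in_fsetU => /orP[] /clP[t <-]; apply/orP; right;
    apply/bigfcupP; exists x; rewrite ?xK // in_fsetU; apply/orP; [right|left];
    by apply/clP; exists t; rewrite -conjVg ?invgK.
- move=> s t; rewrite !in_fset1U => /orP[/eqP ->|/bigfcupP[x]].
    by rewrite conj1g eqxx.
  rewrite andbT => xK; rewrite in_fsetU => /orP[] /clP[u <-]; apply/orP; right;
    apply/bigfcupP; exists x; rewrite ?xK // in_fsetU; apply/orP; [left|right];
    by apply/clP; exists (u * t)%g; rewrite conjgM.
Qed.

Section ProperColoring.
Variables (R : realType) (G : groupType) (X : topologicalType) (a : G -> X -> X).
Hypothesis ha : acts_by_homeomorphisms a.

(** The product of the three-colorings for the single [g], coded in base 3; the exceptional sets are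
    united, each contributing two sets subequivalent to the marker. *)
Lemma proper_coloring (s : seq G) (phi : X -> R) : compact [set: X] -> continuous phi ->
  (forall x, exists h, 0 < phi (a h x)) ->
  (forall g h x, g \in s -> 0 < phi x -> phi (a (g ^ h)%g x) <= 0) ->
  exists (c : X -> nat) (Rs : set X), [/\ closed Rs,
    small a [set x | 0 < phi x] (size s * 2) Rs,
    locally_constant_off Rs c, forall x, (c x < 3 ^ size s)%N &
    forall g x, g \in s -> ~ Rs x -> c (a g x) <> c x].
Proof.
move=> cX cphi GU; elim: s => [|g s IH] Ufree.
  exists (fun=> 0%N), set0; split=> //; first exact: closed0.
  by move=> x _; near=> y.
have [|c [Rs [cR sR lR c3 csep]]] := IH.
  by move=> h t x hs; apply: Ufree; rewrite inE hs orbT.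
have [|d [Rd [cRd sRd lRd d3 dsep]]] := three_coloring (g := g) ha cX cphi GU.
  by move=> h x; apply: Ufree; rewrite mem_head.
exists (fun x => (c x * 3 + d x)%N), (Rd `|` Rs); split.
- exact: closedU.
- by have -> : (size (g :: s) * 2 = 2 + size s * 2)%N by []; exact: smallU.
- move=> x nR; have nRd : ~ Rd x by move=> h; apply: nR; left.
  have nRs : ~ Rs x by move=> h; apply: nR; right.
  by apply: filterS2 (lRd x nRd) (lR x nRs) => y -> ->.
- by move=> x; have := c3 x; have := d3 x; rewrite /= expnS; lia.
- move=> h x; rewrite inE => /orP[/eqP ->|hs] nR e.
    by apply: (dsep x) => [h'|]; [apply: nR; left|have := d3 x; have := d3 (a g x); lia].
  apply: (csep h x hs) => [h'|]; first by apply: nR; right.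
  by have := d3 x; have := d3 (a h x); lia.
Unshelve. all: by end_near. Qed.
End ProperColoring.

Section Castle.
Variables (R : realType) (G : groupType) (X : topologicalType) (a : G -> X -> X).
Hypothesis G_FC : FC_group G.
Hypothesis X_compact : compact [set: X].
Hypothesis X_metrizable : metrizable R X.
Hypothesis ha : acts_by_homeomorphisms a.
Hypothesis a_free : is_free_action a.
Hypothesis a_marker : marker_property a.

Lemma invariant_shapeI (K Sg D : {fset G}) (e : R) : (K `<=` Sg)%fset ->
  (forall s, s \in Sg -> (s^-1)%g \in Sg) ->
  (1 - e) * #|` D|%:R < #|` core Sg D|%:R -> is_invariant_shape K e D.
Proof.
move=> KS SV lt; rewrite /is_invariant_shape.
have sub : [set` core Sg D] `<=`
    \bigcap_(g in [set` K]) [set (g * s)%g | s in [set` D]].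
  move=> x /=; rewrite in_fset_sep => /andP[xD /allP xS] g /= gK.
  exists (g^-1 * x)%g; last by rewrite mulVKg.
  by apply: xS; apply: SV; exact: (fsubsetP KS).
rewrite /counting; case: asboolP => [fin|_]; last by rewrite ltry.
rewrite lte_fin; apply: lt_le_trans lt _; rewrite ler_nat; apply: fsubset_leq_card.
by apply/fsubsetP => x xc; rewrite in_fset_set // inE; apply: sub.
Qed.

Lemma leq_window m n1 n2 t : (m * (2 * n2) <= (window n1 n2 m + t).+1)%N.
Proof. by rewrite /window; nia. Qed.

(** The order of the quantifiers matters: [k] and [B] come before [L], since they depend on the
    radii and the number of colors alone. [V D] consists of the chosen points whose cell has shape
    [D]. *)
Lemma castle_with_small_complement (K : {fset G}) (e : R) : 0 < e ->
  exists (k : nat) (B : {fset G}), forall L : {fset G}, exists (U : set X) (V : {fset G} -> set X),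
  [/\ open U, is_lfree a L U,
    forall D, V D !=set0 -> (D `<=` B)%fset /\ is_invariant_shape K e D,
    forall D, open (V D) &
    (forall D D' g g' x x', V D x -> V D' x' -> g \in D -> g' \in D' ->
      a g x = a g' x' -> D = D' /\ g = g') /\
    small a U k (~` \bigcup_D levels a D (V D))].
Proof.
move=> e0; have [Sg [KS S1 SV SJ]] := FC_generators K G_FC.
pose b n := #|` gball Sg n|.
have bgt n : (0 < b n)%N by exact: card_gball_gt0.
have ble n : (b n <= n.+1 ^ #|` Sg| * b (#|` Sg| * (#|` Sg|)`!))%N.
  by apply: card_gball_polynomial => // s t sS _; exact: SJ.
have [C0 dbl] := doubling bgt ble; pose C := C0.+1.
have S0 : 0 < #|` Sg|%:R :> R.
  by rewrite ltr0n cardfs_gt0; apply/fset0Pn; exists 1%g.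
(* The boundary is measured against the ball of radius [8 * k], while a cell contains the ball of
   radius [k]; [C] bounds the ratio of the two, and the boundary becomes at most [e / 2] of the
   cell. *)
pose e1 : R := e / (2 * #|` Sg|%:R * C%:R).
have e10 : 0 < e1 by rewrite /e1 divr_gt0 // !mulr_gt0.
have [n1 n1b] := exponential_beats ble e10.
have [k [kN bk]] := dbl (3 * n1 + 2)%N.
pose n2 := (2 * k)%N.
have n12 : (3 * n1 + 1 <= n2)%N by rewrite /n2; lia.
have n8 : (4 * n2 = 8 * k)%N by rewrite /n2; lia.
have kn : (k <= n2 - n1)%N by rewrite /n2; lia.
pose Lam := [seq g <- enum_fset (gball Sg (4 * n2)) | g != 1%g].
pose m := (3 ^ size Lam)%N.
pose w := window n1 n2 m.
(* The colors within [N1] determine whether a point is chosen and the shape of its cell; [N2] adds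
   the distance from a point to its center. *)
pose N1 := (w + (2 * n2 + n1)).+1.
have N1D : ((2 * n2 + n1).+1 <= N1)%N by rewrite ltnS leq_addl.
have N1w : (m * (2 * n2) <= N1)%N by exact: leq_window.
pose N2 := (N1 + (2 * n2 + n1))%N.
exists (size (enum_fset (gball Sg N2)) * (size Lam * 2))%N, (gball Sg (2 * n2 + n1)) => L.
pose cl x : {fset G} := fset_set [set conjg x y | y in [set: G]].
(* The coloring requires freeness for 1 and the conjugates of the elements of [Lam]; [L] is added
   for the conclusion. *)
have [U [[Uo GU] Ufree]] := a_marker
  ([fset 1%g] `|` L `|` \bigcup_(g <- Lam) cl g)%fset.
have [phi [cphi phi0 phiU]] := open_positive_function X_metrizable Uo.
have UE : U = [set x | 0 < phi x] by apply/seteqP; split=> x /phiU.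
have [|g h x gL /phiU Ux|c0 [R0 [cR0 sR0 lR0 c3 csep]]] :=
  @proper_coloring R G X a ha Lam phi X_compact cphi.
- move=> x; have [h _ [y Uy yx]] : (\bigcup_g (a g @` U)) x by rewrite GU.
  by exists (h^-1)%g; apply/phiU; rewrite -yx act_mulK.
- rewrite leNgt; apply/negP => /phiU Ugx.
  have : (g ^ h)%g = 1%g.
    apply: (Ufree (g ^ h)%g 1%g) => /=.
    + rewrite !in_fsetU in_fset1; apply/orP; right; apply/bigfcupP; exists g.
        by rewrite gL.
      by rewrite in_fset_set ?inE; [exists h|exact: G_FC].
    + by rewrite !in_fsetU in_fset1 eqxx.
    + exists (a (g ^ h)%g x); split; first by exists x.
      by exists (a (g ^ h)%g x) => //; rewrite act1.
  by move/eqP; rewrite conjg_eq1; move: gL; rewrite mem_filter => /andP[/negPf ->].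
pose c x := if `[< R0 x >] then m else c0 x.
have cm x : (c x < m)%N <-> ~ R0 x.
  rewrite /c; case: asboolP => [h|h]; first by rewrite ltnn; split.
  by split=> // _; exact: c3.
have sep z g : (c z < m)%N -> g \in gball Sg (4 * n2) -> g != 1%g -> c (a g z) != c z.
  move=> cz gB g1; have nR := (cm z).1 cz; apply/eqP => e'.
  have gz : (c (a g z) < m)%N by rewrite e'.
  apply: (csep g z) => //; first by rewrite mem_filter g1.
  have h : c0 (a g z) = c (a g z) by rewrite /c asboolF //; exact/cm.
  by rewrite h e' /c asboolF.
have a1 := act1 ha; have aM := actM ha.
pose ctr := center Sg a e1 n1 n2 m c.
pose shp := shape Sg a e1 n1 n2 m c.
pose mis := inn Sg a n2 c m.
pose V (D : {fset G}) := [set t | [/\ forall g, g \in gball Sg N1 -> ~ R0 (a g t),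
  mis t & shp t = D]].
have colored M t : (M <= N1)%N -> (forall g, g \in gball Sg N1 -> ~ R0 (a g t)) ->
    forall g, g \in gball Sg M -> (c (a g t) < m)%N.
  by move=> MN ct g gB; apply/cm/ct; exact: gball_le gB.
have ctr_ball z : (c z < m)%N -> ctr z \in gball Sg (2 * n2 + n1).
  by move=> cz; apply: center_gball.
exists U, V; split=> //.
- apply: sub_trivIset Ufree => g /= gL; rewrite !in_fsetU; apply/orP; left.
  by apply/orP; right.
- move=> D [t [ct it <-]]; split.
    by apply/fsubsetP => g; rewrite in_fset_sep => /andP[].
  apply: (@invariant_shapeI K Sg) => //.
  have col : forall g, g \in gball Sg (2 * n2 + n1).+1 -> (c (a g t) < m)%N.
    exact: colored.
  have inv := shape_invariant S1 SV a1 aM sep n12 e10 n1b it col.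
  have col' : forall g, g \in gball Sg (2 * n2 + n1) -> (c (a g t) < m)%N.
    by apply: colored => //; exact: ltnW.
  have sub := gball_sub_shape S1 SV a1 aM e1 sep n12 it col'.
  rewrite -/(shp t) in inv sub.
  set D1 := shp t in inv sub *.
  have cD : (b k <= #|` D1|)%N.
    apply: leq_trans (fsubset_leq_card sub); exact/fsubset_leq_card/subset_gball.
  have D0 : 0 < #|` D1|%:R :> R by rewrite ltr0n (leq_trans (bgt k)).
  have cs : #|` D1|%:R = #|` D1 `\` core Sg D1|%fset%:R + #|` core Sg D1|%:R :> R.
    rewrite -natrD; congr _%:R; rewrite cardfsDS ?subnK //.
      by apply/fsubset_leq_card/fsubsetP => x; rewrite in_fset_sep => /andP[].
    by apply/fsubsetP => x; rewrite in_fset_sep => /andP[].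
  have bC : (b (8 * k))%:R <= C%:R * #|` D1|%:R :> R.
    rewrite -natrM ler_nat (leq_trans bk) // leq_mul // leqnSn.
  have h : #|` Sg|%:R * (e1 * (b (8 * k))%:R) <= e / 2 * #|` D1|%:R :> R.
    have -> : e / 2 * #|` D1|%:R = #|` Sg|%:R * (e1 * (C%:R * #|` D1|%:R)) :> R.
      rewrite /e1; have : C%:R != 0 :> R by rewrite pnatr_eq0.
      move: (C%:R) => C' C'0; field; rewrite C'0 lt0r_neq0 //.
    by rewrite ler_pM2l // ler_pM2l.
  rewrite n8 in inv; have := le_trans inv h.
  have De : 0 < e * #|` D1|%:R by rewrite mulr_gt0.
  by move: cs; move: (#|` D1|%:R) De => d De; lra.
- move=> D; rewrite openE => t [ct it sD]; rewrite /interior.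
  (* Near [t] the colors on the whole ball [gball Sg N1] do not change, hence neither do the
     membership in [mis] and the shape. *)
  have near_c : \forall t' \near t, forall g, g \in gball Sg N1 ->
      c (a g t') = c (a g t) /\ ~ R0 (a g t').
    have : \forall t' \near t, forall u : gball Sg N1,
        c0 (a (val u) t') = c0 (a (val u) t) /\ ~ R0 (a (val u) t').
      apply: filter_forall => u; have nR := ct _ (valP u).
      have cu : a (val u) t' @[t' --> t] --> a (val u) t by exact: act_continuous.
      have nbR : nbhs (a (val u) t) (~` R0).
        by apply: open_nbhs_nbhs; split=> //; exact: closed_openC.
      have h1 := cu _ (lR0 _ nR); have h2 := cu _ nbR.
      by near=> t'; split; near: t'; [exact: h1|exact: h2].
    apply: filterS => t' ht g gB; have [h1 h2] := ht [` gB]%fset; split=> //=.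
    by rewrite /c !asboolF //; exact: ct.
  apply: filterS near_c => t' ht.
  have simt : sim Sg a c N1 t t' by move=> g /ht[].
  split; first by move=> g /ht[].
    rewrite /mis -(@inn_local G Sg S1 X a a1 aM n2 c m t t') //.
    exact: sim_le simt.
  rewrite -sD; apply/fsetP => g; rewrite !in_fset_sep.
  case: (boolP (g \in gball Sg _)) => //= gB; congr (_ == _).
  have cgt : (c (a g t) < m)%N by apply: (colored (2 * n2 + n1)%N) => //; exact: ltnW.
  apply: esym; apply: (center_local S1 a1 aM n12 e10 n1b cgt).
  by apply: sim_shift gB _ => //; apply: sim_le simt => //; exact: leqnSn.
split.
- move=> D D' g g' x x' [ct it sD] [ct' it' sD'] gD gD' e'.
  have cg t h : h \in shp t -> ctr (a h t) = (h^-1)%g.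
    by rewrite in_fset_sep => /andP[_ /eqP].
  rewrite -sD in gD; rewrite -sD' in gD'.
  have xx : x = x'.
    have := cg _ _ gD; rewrite e' (cg _ _ gD') => /invg_inj hg.
    by move: e'; rewrite hg => /(congr1 (a (g^-1)%g)); rewrite -!aM mulVg !a1.
  rewrite -sD -sD' xx; split=> //; rewrite xx in e'.
  exact: (act_inj a1 aM a_free e').
(* A point outside the castle sees [R0] within [gball Sg N2]: otherwise its center would be the base
   point of a tower containing it. *)
- rewrite UE; apply: small_sub (small_window ha (enum_fset (gball Sg N2)) sR0) => z nz.
  apply: contrapT => nb; apply: nz; have cz g : g \in gball Sg N2 -> ~ R0 (a g z).
    by move=> gB Rg; apply: nb; exists g.
  have colz : (c z < m)%N.
    by apply/cm; rewrite -[z]a1; apply: cz; exact: gball_one.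
  pose t := a (ctr z) z.
  have ct : forall g, g \in gball Sg N1 -> ~ R0 (a g t).
    by move=> g gB; rewrite -aM; apply: cz; rewrite gball_mul // ctr_ball.
  exists (shp t) => //; exists ((ctr z)^-1)%g => /=; last first.
    exists t; last by rewrite /t -aM mulVg a1.
    split=> //; exact: (center_inn S1 a1 aM e1 n12 colz).
  rewrite in_fset_sep invgK; apply/andP; split; first exact/gball_inv/ctr_ball.
  by rewrite /t -aM mulVg a1.
Unshelve. all: by end_near. Qed.
End Castle.

(** * Invariant means *)

(** Balls at a radius where the next one is larger by a factor at most [1 + e]: the translate by a
    generator lies in the next ball. *)
Lemma FC_Folner (R : realType) (G : groupType) (K : {fset G}) (e : R) : FC_group G ->
  0 < e -> exists E : {fset G}, E != fset0 /\
    forall g, g \in K -> #|` [fset (g * s)%g | s in E] `\` E|%fset%:R <= e * #|` E|%:R.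
Proof.
move=> FC e0; have [Sg [KS S1 SV SJ]] := FC_generators K FC.
pose b n := #|` gball Sg n|.
have ble n : (b n <= n.+1 ^ #|` Sg| * b (#|` Sg| * (#|` Sg|)`!))%N.
  by apply: card_gball_polynomial => // s t sS _; exact: SJ.
have bgt n : (0 < b n)%N by exact: card_gball_gt0.
have [n nb] := almost_invariant_step bgt ble e0; exists (gball Sg n); split.
  by apply/fset0Pn; exists 1%g; exact: gball_one.
move=> g gK; apply: (@le_trans _ _ (b n.+1 - b n)%N%:R); last first.
  rewrite natrB; last exact/fsubset_leq_card/subset_gball.
  by rewrite lerBlDr; move: nb; rewrite mulrDl mul1r addrC.
rewrite ler_nat /b -cardfsDS; last exact: subset_gball.
apply/fsubset_leq_card/fsubsetP => x; rewrite !in_fsetD => /andP[-> /imfsetP[s /= sB ->]].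
exact: (@gball_mul _ _ 1 n _ _ (gball_gen (fsubsetP KS _ gK)) sB).
Qed.

Lemma ultrafilter_cvg (R : realType) (F : set_system nat) (u : nat -> R) :
  UltraFilter F -> (forall n, 0 <= u n <= 1) -> exists l : R, u n @[n --> F] --> l.
Proof.
move=> UF u01; have [|p [_ cp]] := @segment_compact R 0 1 (u n @[n --> F]) _.
  have -> : (u n @[n --> F]) [set` `[0, 1]] = F setT; last exact: filterT.
  by congr F; apply/seteqP; split=> // n _; rewrite /= in_itv /= u01.
exists p => N Np; have [//|FN] := in_ultra_setVsetC (u @^-1` N) UF.
have [x [nx xN]] := cp (~` N) N FN Np.
by case: nx.
Qed.

Section Means.
Variables (R : realType) (G : groupType) (X : topologicalType) (a : G -> X -> X).
Hypothesis ha : acts_by_homeomorphisms a.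

Record invariant_mean (m : set X -> R) : Prop := InvariantMean {
  mean_ge0 : forall A, 0 <= m A;
  mean_setT : m setT = 1;
  meanU : forall A B, (forall x, A x -> ~ B x) -> m (A `|` B) = m A + m B;
  mean_act : forall g A, m (a g @^-1` A) = m A }.

Definition visits (E : {fset G}) (x : X) (A : set X) : {fset G} :=
  [fset g in E | `[< A (a g x) >]]%fset.

Definition average (E : {fset G}) (x : X) (A : set X) : R :=
  #|` visits E x A|%:R / #|` E|%:R.

Lemma visitsP E x A g : reflect (g \in E /\ A (a g x)) (g \in visits E x A).
Proof. by rewrite in_fset_sep; apply: (iffP andP) => -[-> /asboolP]. Qed.

Lemma average_itv E x A : 0 <= average E x A <= 1.
Proof.
apply/andP; split; first exact: divr_ge0.
have [->|E0] := eqVneq E fset0.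
  by rewrite /average cardfs0 invr0 mulr0.
rewrite ler_pdivrMr ?ltr0n ?cardfs_gt0 // mul1r ler_nat.
by apply/fsubset_leq_card/fsubsetP => g /visitsP[].
Qed.

(** The limit of the averages along an ultrafilter. The points [x n] may vary, as the invariance
    comes from the sets [E n] alone. *)
Lemma mean_exists (E : nat -> {fset G}) (x : nat -> X) :
  (forall n, E n != fset0) ->
  (forall (g : G) (e : R), 0 < e -> \forall n \near \oo,
    #|` [fset (g * s)%g | s in E n] `\` E n|%fset%:R <= e * #|` E n|%:R) ->
  exists m : set X -> R, [/\ invariant_mean m,
    forall A r, (forall n, r <= average (E n) (x n) A) -> r <= m A &
    forall A B, (forall n, average (E n) (x n) A <= average (E n) (x n) B) -> m A <= m B].
Proof.
move=> E0 EF; have [F [UF Foo]] := ultraFilterLemma (@eventually_filter).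
have /choice[m mc] : forall A : set X, exists l : R,
    average (E n) (x n) A @[n --> F] --> l.
  by move=> A; apply: ultrafilter_cvg => n; exact: average_itv.
have En0 n : 0 < #|` E n|%:R :> R by rewrite ltr0n cardfs_gt0.
have le A r : (forall n, r <= average (E n) (x n) A) -> r <= m A.
  move=> h; apply: (@closed_cvg _ _ F _ _ (fun y => r <= y) (@closed_ge R r) _ _ (mc A)).
  by near=> n; exact: h.
have leAB A B : (forall n, average (E n) (x n) A <= average (E n) (x n) B) -> m A <= m B.
  move=> h; rewrite -subr_ge0.
  have mBA : average (E n) (x n) B - average (E n) (x n) A @[n --> F] --> m B - m A.
    exact: cvgB (mc B) (mc A).
  have cl := @closed_cvg _ _ F _ _ (fun y : R => 0 <= y) (@closed_ge R 0) _ _ mBA.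
  by apply: cl; near=> n; rewrite /= subr_ge0.
have eqm A l : average (E n) (x n) A @[n --> F] --> l -> m A = l.
  by move=> h; apply: cvg_unique (mc A) h; exact: Rhausdorff.
exists m; split=> //; split.
- by move=> A; apply: le => n; case/andP: (average_itv (E n) (x n) A).
- apply: eqm; apply: cvg_near_cst; near=> n.
  rewrite /average (_ : visits _ _ _ = E n) ?divff ?lt0r_neq0 //.
  by apply/fsetP => g; apply/visitsP/idP => [[]|].
- move=> A B AB; apply: eqm.
  rewrite (_ : (fun n => _) = (fun n => average (E n) (x n) A + average (E n) (x n) B)).
    exact: cvgD (mc A) (mc B).
  apply/funext => n; rewrite /average -mulrDl -natrD; congr (_%:R / _).
  rewrite -cardfsUI [X in (_ + #|` X|)%N](_ : _ = fset0) ?cardfs0 ?addn0.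
    congr #|` _|; apply/fsetP => g; rewrite in_fsetU; apply/visitsP/orP.
      by case=> gE [Ag|Bg]; [left|right]; apply/visitsP.
    by case=> /visitsP[gE h]; split=> //; [left|right].
  apply/fsetP => g; rewrite in_fsetI in_fset0; apply/negbTE/negP.
  by move=> /andP[/visitsP[_ Ag] /visitsP[_]]; exact: AB.
- move=> g A; apply: eqm.
  (* Translation by [g] changes the count by at most the number of elements that [g] or its inverse
     moves out of [E n]. *)
  have d0 : average (E n) (x n) (a g @^-1` A) - average (E n) (x n) A @[n --> F] --> (0 : R).
    apply/cvgr0Pnorm_le => e e0; apply: Foo.
    near=> n; rewrite /average -mulrBl normrM [X in _ * X]gtr0_norm ?invr_gt0 //.
    rewrite ler_pdivrMr //.
    have h1 : #|` [fset (g * s)%g | s in E n] `\` E n|%fset%:R <= e * #|` E n|%:R.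
      by near: n; exact: EF.
    have h2 : #|` [fset (g^-1 * s)%g | s in E n] `\` E n|%fset%:R <= e * #|` E n|%:R.
      by near: n; exact: EF.
    pose P := visits (E n) (x n) (a g @^-1` A); pose Q := visits (E n) (x n) A.
    have PQ : (#|` P| <= #|` Q| + #|` [fset (g * s)%g | s in E n] `\` E n|%fset)%N.
      rewrite -(card_fset_image P (mulgI g)).
      apply: leq_trans (leq_card_fsetU _ _); apply/fsubset_leq_card/fsubsetP => y.
      case/imfsetP => s /= /visitsP[sE As] ->; rewrite in_fsetU in_fsetD.
      have [gsE|gsE] := boolP ((g * s)%g \in E n); apply/orP.
        by left; apply/visitsP; split=> //; rewrite (actM ha).
      by right; rewrite /=; apply/imfsetP; exists s.
    have QP : (#|` Q| <= #|` P| + #|` [fset (g^-1 * s)%g | s in E n] `\` E n|%fset)%N.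
      rewrite -(card_fset_image Q (mulgI (g^-1)%g)).
      apply: leq_trans (leq_card_fsetU _ _); apply/fsubset_leq_card/fsubsetP => y.
      case/imfsetP => s /= /visitsP[sE As] ->; rewrite in_fsetU in_fsetD.
      have [gsE|gsE] := boolP ((g^-1 * s)%g \in E n); apply/orP.
        by left; apply/visitsP; split=> //=; rewrite -(actM ha) mulVKg.
      by right; rewrite /=; apply/imfsetP; exists s.
    move: PQ QP; rewrite -/P -/Q -!(ler_nat R) !natrD => PQ QP.
    by rewrite ler_norml; apply/andP; split; lra.
  rewrite -[m A]addr0 addrC.
  rewrite (_ : (fun n => _) = (fun n => (average (E n) (x n) (a g @^-1` A) -
     average (E n) (x n) A) + average (E n) (x n) A)).
    exact: cvgD d0 (mc A).
  by apply/funext => n; rewrite subrK.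
Unshelve. all: by end_near. Qed.
End Means.

Lemma countably_infinite_enum (T : Type) : countably_infinite T ->
  exists f : nat -> T, injective f /\ forall x, exists n, f n = x.
Proof.
rewrite /countably_infinite => /card_set_bijP[h [_ hi hs]].
have /choice[f fh] : forall n, exists x, h x = n.
  by move=> n; have [//|x _ <-] := hs n; exists x.
exists f; split; first by move=> i j e; rewrite -(fh i) e fh.
by move=> x; exists (h x); apply: hi; rewrite ?inE.
Qed.

Lemma infinite_fset (G : choiceType) n : countably_infinite G ->
  exists L : {fset G}, #|` L| = n.
Proof.
move=> /countably_infinite_enum[f [fi _]]; exists [fset f i | i in iota 0 n]%fset.
by rewrite card_imfset //= undup_id ?iota_uniq // size_iota.
Qed.

Lemma Folner_sequence (R : realType) (G : groupType) :
  countably_infinite G -> FC_group G ->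
  exists E : nat -> {fset G}, (forall n, E n != fset0) /\
  forall (g : G) (e : R), 0 < e -> \forall n \near \oo,
    #|` [fset (g * s)%g | s in E n] `\` E n|%fset%:R <= e * #|` E n|%:R.
Proof.
move=> /countably_infinite_enum[f [_ fs]] FC.
have /choice[E EP] : forall n : nat, exists E : {fset G}, E != fset0 /\
    forall g, g \in [fset f i | i in iota 0 n]%fset ->
    #|` [fset (g * s)%g | s in E] `\` E|%fset%:R <= n.+1%:R^-1 * #|` E|%:R :> R.
  by move=> n; apply: FC_Folner.
exists E; split=> [n|g e e0]; first by case: (EP n).
have [i fi] := fs g; near=> n.
have [_ /(_ g) h] := EP n; apply: le_trans (h _) _.
  apply/imfsetP; exists i => //=; rewrite mem_iota add0n /=.
  by near: n; exists i.+1.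
rewrite ler_wpM2r //; apply: ltW; near: n; exact: (near_infty_natSinv_lt (PosNum e0)).
Unshelve. all: by end_near. Qed.

Section MeanLemmas.
Variables (R : realType) (G : groupType) (X : topologicalType) (a : G -> X -> X).
Hypothesis ha : acts_by_homeomorphisms a.
Variable m : set X -> R.
Hypothesis mm : invariant_mean a m.

Lemma mean_le (A B : set X) : A `<=` B -> m A <= m B.
Proof.
move=> AB; rewrite -(setDUK AB) (meanU mm) ?lerDl ?(mean_ge0 mm) // => x Ax [_]; exact.
Qed.

Lemma mean_set0 : m set0 = 0.
Proof.
have := meanU mm (A := set0) (B := set0) (fun _ h => False_ind _ h).
by rewrite setU0 => /eqP; rewrite -subr_eq subrr eq_sym => /eqP.
Qed.

Lemma meanU_le (A B : set X) : m (A `|` B) <= m A + m B.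
Proof.
have -> : A `|` B = A `|` (B `\` A).
  apply/seteqP; split=> [x [|Bx]|x [|[]]]; [by left| |by left|by right].
  by have [Ax|nA] := pselect (A x); [left|right].
rewrite (meanU mm) ?lerD2l; last by move=> x Ax [_]; exact.
by apply: mean_le => x [].
Qed.

Lemma mean_bigU_le (I : Type) (s : seq I) (A : I -> set X) :
  m (\big[setU/set0]_(i <- s) A i) <= \sum_(i <- s) m (A i).
Proof.
elim: s => [|i s IH]; first by rewrite !big_nil mean_set0.
by rewrite !big_cons; apply: le_trans (meanU_le _ _) _; rewrite lerD2l.
Qed.

Lemma mean_bigU (I : choiceType) (s : seq I) (A : I -> set X) : uniq s ->
  (forall i j x, i \in s -> j \in s -> A i x -> A j x -> i = j) ->
  m (\big[setU/set0]_(i <- s) A i) = \sum_(i <- s) m (A i).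
Proof.
elim: s => [|i s IH] /=; first by rewrite !big_nil mean_set0.
case/andP=> ni us dis; rewrite !big_cons (meanU mm) ?IH //.
  by move=> j k x js ks; apply: dis; rewrite inE ?js ?ks orbT.
move=> x Ax; rewrite -bigcup_seq => -[j /= js Aj].
have e := dis i j x (mem_head _ _) _ Ax Aj; move: ni; rewrite e ?js //.
by rewrite inE js orbT.
Qed.

Lemma mean_image g A : m (a g @` A) = m A.
Proof. by rewrite (act_image ha) (mean_act mm). Qed.

Lemma mean_subequivalent (A B : set X) : is_subequivalent a A B -> m A <= m B.
Proof.
move=> /subequivalentE[n [V [g [Vo AV dis VB]]]].
apply: (@le_trans _ _ (m (\big[setU/set0]_(i <- enum 'I_n) V i))).
  by apply: mean_le => x /AV[i Vi]; rewrite -bigcup_seq; exists i; rewrite //= mem_enum.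
apply: le_trans (mean_bigU_le _ _) _.
rewrite (eq_bigr (fun i => m (a (g i) @` V i))); last by move=> i _; rewrite mean_image.
rewrite -mean_bigU ?enum_uniq //; last first.
  by move=> i j x _ _ [y Vy <-] [z Vz] /esym e; exact: dis Vy Vz e.
apply: mean_le => x; rewrite -bigcup_seq => -[i _ [y Vy <-]]; exact: VB.
Qed.

Lemma mean_small U k A : small a U k A -> m A <= k%:R * m U.
Proof.
elim: k A => [|k IH] A /=.
  by move=> /mean_le; rewrite mean_set0 mul0r.
case=> R1 [R2 [AR sR1 /IH sR2]]; apply: le_trans (mean_le AR) _.
apply: le_trans (meanU_le _ _) _; rewrite -natr1 mulrDl mul1r addrC lerD //.
exact: mean_subequivalent.
Qed.

Lemma mean_lfree (L : {fset G}) U : is_lfree a L U -> #|` L|%:R * m U <= 1.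
Proof.
move=> LU; rewrite -[leRHS](mean_setT mm).
have -> : #|` L|%:R * m U = \sum_(g <- enum_fset L) m (a g @` U).
  rewrite (eq_bigr (fun=> m U)); last by move=> g _; exact: mean_image.
  by rewrite big_const_seq count_predT iter_addr_0 mulr_natl.
rewrite -mean_bigU ?fset_uniq //; first by apply: mean_le.
by move=> g h x gL hL gx hx; apply: LU => //; exists x.
Qed.
End MeanLemmas.

(** * Upper Banach density and invariant means *)

Section Density.
Variables (R : realType) (G : groupType) (X : topologicalType) (a : G -> X -> X).
Hypothesis ha : acts_by_homeomorphisms a.
Hypothesis a_free : is_free_action a.

Lemma orbit_ratioE (F : {fset G}) (A : set X) x :
  #|` fset_set (A `&` [set a g x | g in [set` F]])|%:R / #|` F|%:R
  = average R a F x A.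
Proof.
congr (_%:R / _); have -> : fset_set (A `&` [set a g x | g in [set` F]]) =
    [fset a g x | g in visits a F x A]%fset.
  apply/fsetP => y; rewrite in_fset_set.
    apply/idP/imfsetP => [|[g /= /visitsP[gF Ag] ->]].
      by rewrite inE => -[Ay [g /= gF gy]]; exists g; rewrite //=; apply/visitsP; rewrite gy.
    by rewrite inE; split=> //; exists g.
  apply: finite_setIr; apply: finite_image; exact: finite_fset.
by rewrite card_in_imfset // => g h _ _; exact: act_inj (act1 ha) (actM ha) a_free _ _ _.
Qed.

(** If the density were at least [e], every Folner set would have average at least [r] at some
    point, and so would a limit mean. The number [r] lies strictly between [e'] and [e], since the
    supremum need not be attained. *)
Lemma upper_banach_density_lt (A : set X) (e' e : R) :
  countably_infinite G -> FC_group G -> e' < e -> 0 < e ->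
  (forall m : set X -> R, invariant_mean a m -> m A <= e') ->
  upper_banach_density R a A < e.
Proof.
move=> Gc FC ee e0 h; rewrite ltNge; apply/negP => eD.
pose SF (F : {fset G}) := [set #|` fset_set (A `&` [set a g x | g in [set` F]])|%:R
                      / #|` F|%:R | x in [set: X]] : set R.
have SFE F : SF F = [set average R a F x A | x in [set: X]].
  by apply/seteqP; split=> _ [x _ <-]; exists x => //; rewrite orbit_ratioE.
have hub F : has_ubound (SF F).
  by rewrite SFE; exists 1 => _ [x _ <-]; case/andP: (average_itv R a F x A).
have SF0 F : ~ (exists x : X, True) -> SF F = set0.
  by move=> X0; rewrite -subset0 => y [x _ _]; case: X0; exists x.
have sup_ge F : 0 <= sup (SF F).
  have [[x _]|X0] := pselect (exists x : X, True); last first.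
    by rewrite SF0 // sup0.
  apply: (@le_trans _ _ (average R a F x A)).
    by case/andP: (average_itv R a F x A).
  by apply: ub_le_sup => //; rewrite SFE; exists x.
have eF F : F != fset0 -> e <= sup (SF F).
  move=> F0; apply: le_trans eD _; apply: ge_inf; last by exists F.
  by exists 0 => _ [F' _ <-]; exact: sup_ge.
have [E [E0 EF]] := Folner_sequence R Gc FC.
pose r := (e' + e) / 2.
have /choice[x xP] : forall n, exists x, r <= average R a (E n) x A.
  move=> n; apply: contrapT => nx; have := eF _ (E0 n); apply/negP; rewrite -ltNge.
  have [[x0 _]|X0] := pselect (exists x : X, True); last first.
    by rewrite SF0 // sup0.
  apply: (@le_lt_trans _ _ r); last by rewrite /r; lra.
  apply: ge_sup; first by rewrite SFE; exists (average R a (E n) x0 A), x0.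
  rewrite SFE => _ [x _ <-]; apply: ltW; rewrite ltNge; apply/negP => rx.
  by apply: nx; exists x.
have [m [mm mge _]] := mean_exists ha x E0 EF.
by have := mge _ _ xP; have := h m mm; rewrite /r; lra.
Qed.
End Density.

(** * The marker property and URP *)

Section MarkerURP.
Variables (R : realType) (G : groupType) (X : topologicalType) (a : G -> X -> X).
Hypothesis G_count : countably_infinite G.
Hypothesis G_FC : FC_group G.
Hypothesis X_compact : compact [set: X].
Hypothesis X_metrizable : metrizable R X.
Hypothesis ha : acts_by_homeomorphisms a.
Hypothesis a_free : is_free_action a.

Lemma marker_URP : marker_property a -> URP R a.
Proof.
move=> a_marker K e e0.
have [k [B castle]] := castle_with_small_complement G_FC X_compact X_metrizable
  ha a_free a_marker K e0.
(* With more than [k / (e / 2)] elements in [L], the complement has mean at most [e / 2]. *)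
have [L Lk] := infinite_fset (Num.bound (k%:R / (e / 2))).+1 G_count.
have [U [V [Uo LU VD Vo [dis sm]]]] := castle L.
(* Only the shapes of nonempty towers are kept: they are finitely many, and invariance is known for
   these. *)
pose s := [seq D <- enum_fset (fpowerset B) | `[< V D !=set0 >]].
have us : uniq s by rewrite filter_uniq ?fset_uniq.
have sP i : (i < size s)%N -> V (nth fset0 s i) !=set0.
  by move=> /(mem_nth fset0); rewrite mem_filter => /andP[/asboolP].
exists (size s), (fun i => nth fset0 s i), (fun i => V (nth fset0 s i)); split.
- split=> [i|i j _ _ [_ [[g gD [x Vx <-]] [h hD [y Vy /esym e']]]]].
    split=> // g h gD hD [_ [[x Vx <-] [y Vy /esym e']]].
    by have [] := dis _ _ _ _ _ _ Vx Vy gD hD e'.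
  apply: val_inj; apply/eqP; rewrite -(nth_uniq fset0 (ltn_ord i) (ltn_ord j) us); apply/eqP.
  by have [] := dis _ _ _ _ _ _ Vx Vy gD hD e'.
- by move=> i; have [] := VD _ (sP i (ltn_ord i)).
apply: (upper_banach_density_lt ha a_free (e' := e / 2)) => //; first by lra.
move=> m mm; apply: (@le_trans _ _ (m (~` \bigcup_D levels a D (V D)))).
  apply: (mean_le mm) => x nx [D _ xD]; apply: nx.
  have Ds : D \in s.
    rewrite mem_filter; apply/andP; split.
      by apply/asboolP; case: xD => g _ [y Vy _]; exists y.
    rewrite fpowersetE; have [|//] := VD D.
    by case: xD => g _ [y Vy _]; exists y.
  have iD : (index D s < size s)%N by rewrite index_mem.
  by exists (Ordinal iD) => //=; rewrite nth_index.
apply: le_trans (mean_small ha mm sm) _.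
have := mean_lfree ha mm LU; rewrite Lk => mU.
have e20 : 0 < e / 2 by rewrite divr_gt0.
have kb : k%:R / (e / 2) < (Num.bound (k%:R / (e / 2)))%:R.
  by apply: archi_boundP; rewrite divr_ge0 // ltW.
move: kb mU; set N := Num.bound _; rewrite -[N.+1%:R]natr1 ltr_pdivrMr // => kb mU.
have mU0 := mean_ge0 mm U; have : k%:R * m U <= (N%:R * (e / 2)) * m U.
  by rewrite ler_wpM2r // ltW.
have : (e / 2) * ((N%:R + 1) * m U) <= (e / 2) * 1 by rewrite ler_wpM2l // ltW.
have : 0 <= e / 2 * m U by rewrite mulr_ge0 // ltW.
move: (m U) mU0 => u u0 h1 h2 h3; nra.
Qed.

Lemma URP_marker : URP R a -> marker_property a.
Proof.
move=> urp L; pose K := (1%g |` [fset (g^-1)%g | g in L])%fset.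
have [|n [S [V [[tow dis] inv dens]]]] := urp K (2^-1 : R); first by rewrite invr_gt0.
have /choice[t tP] : forall i : 'I_n, exists t, t \in S i /\
    forall g, g \in L -> (g * t)%g \in S i.
  move=> i; have := inv i; rewrite /is_invariant_shape => lt.
  have [t tK] : \bigcap_(g in [set` K]) [set (g * s)%g | s in [set` S i]] !=set0.
    apply/set0P/eqP => e0; move: lt; rewrite e0 /counting asboolT; last exact: finite_set0.
    rewrite fset_set0 cardfs0 lte_fin ltNge mulr_ge0 //; lra.
  exists t; split=> [|g gL].
    have [|s sS <-] := tK 1%g; first by rewrite /= in_fset1U eqxx.
    by rewrite mul1g.
  have [|s sS <-] := tK (g^-1)%g; last by rewrite mulVKg.
  by rewrite /= in_fset1U; apply/orP; right; apply/imfsetP; exists g.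
pose U := \bigcup_i (a (t i) @` V i).
exists U; split.
  split; first by apply: bigcup_open => i _; apply: open_image_act => //; case: (tow i).
  apply/seteqP; split=> // x _; apply: contrapT => nx.
  (* An orbit that misses [U] avoids the whole castle, so its averages over every [F] equal 1 and
     the density of the complement is at least 1. *)
  have out h : (~` (\bigcup_i levels a (S i) (V i))) (a h x).
    move=> [i _ [g gS [y Vy e]]]; apply: nx; exists (h^-1 * (g * (t i)^-1))%g => //.
    exists (a (t i) y); first by exists i => //; exists y.
    by rewrite !(actM ha) (act_mulK ha) e (act_mulK ha).
  move: dens; apply/negP; rewrite -leNgt; apply: (@le_trans _ _ 1).
    by rewrite invf_le1 // ler1n.
  apply: lb_le_inf; first (eexists; exists [fset 1%g]%fset) => //=.
    by apply/fset0Pn; exists 1%g; rewrite inE.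
  move=> _ [F F0 <-]; apply: (@le_trans _ _ (average R a F x (~` \bigcup_i levels a (S i) (V i)))).
    rewrite /average (_ : visits _ _ _ _ = F) ?divff // ?pnatr_eq0 ?cardfs_eq0 //.
    by apply/fsetP => g; apply/visitsP/idP => [[]|].
  apply: ub_le_sup; last by exists x => //; rewrite orbit_ratioE.
  exists 1 => _ [z _ <-]; rewrite orbit_ratioE //.
  by case/andP: (average_itv R a F z (~` \bigcup_i levels a (S i) (V i))).
move=> g h gL hL [_ [[_ [i _ [x Vx <-]] <-] [_ [j _ [y Vy <-]]]]] /esym.
rewrite -!(actM ha) => e; have ij : i = j.
  apply: dis => //; exists (a (g * t i)%g x); split.
    by exists (g * t i)%g; [exact: (tP i).2|exists x].
  by rewrite e; exists (h * t j)%g; [exact: (tP j).2|exists y].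
rewrite -ij in e Vy; have [_ Sfree] := tow i.
have : (g * t i)%g = (h * t i)%g.
  apply: Sfree; [exact: (tP i).2|exact: (tP i).2|exists (a (g * t i)%g x)].
  by split; [exists x|rewrite e; exists y].
exact: mulIg.
Qed.
End MarkerURP.

(** * From invariant means to invariant measures *)

Section MeasureOfMean.
Variables (R : realType) (G : groupType) (X : topologicalType) (a : G -> X -> X).
Hypothesis X_compact : compact [set: X].
Hypothesis X_metrizable : metrizable R X.
Hypothesis ha : acts_by_homeomorphisms a.
Variables (m : set X -> R) (mm : invariant_mean a m).

(** Regularization of the mean: on open sets by closed subsets, then on all sets by open supersets.
    Compactness turns finite into countable subadditivity. *)
Definition inner (U : set X) : R := sup [set m C | C in [set C | closed C /\ C `<=` U]].
Definition outer (Y : set X) : R := inf [set inner U | U in [set U | open U /\ Y `<=` U]].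

Lemma inner_ge U C : closed C -> C `<=` U -> m C <= inner U.
Proof.
move=> Cc CU; apply: sup_ubound; last by exists C.
by exists 1 => _ [D _ <-]; rewrite -(mean_setT mm); apply: (mean_le mm).
Qed.

Lemma inner_le U r : (forall C, closed C -> C `<=` U -> m C <= r) -> inner U <= r.
Proof.
move=> h; apply: sup_le_ub; first by exists (m set0), set0 => //; split=> //; exact: closed0.
by move=> _ [C [Cc CU] <-]; exact: h.
Qed.

Lemma inner_ge0 U : 0 <= inner U.
Proof. by apply: le_trans (inner_ge closed0 (@sub0set _ U)); exact: mean_ge0 mm _. Qed.

Lemma outer_le Y U : open U -> Y `<=` U -> outer Y <= inner U.
Proof.
move=> Uo YU; apply: inf_lbound; last by exists U.
by exists 0 => _ [V _ <-]; exact: inner_ge0.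
Qed.

Lemma outer_ge Y r : (forall U, open U -> Y `<=` U -> r <= inner U) -> r <= outer Y.
Proof.
move=> h; apply: lb_le_inf; first by exists (inner setT), setT => //; split=> //; exact: openT.
by move=> _ [U [Uo YU] <-]; exact: h.
Qed.

Lemma outer_adherent Y e : 0 < e -> exists U, [/\ open U, Y `<=` U & inner U < outer Y + e].
Proof.
move=> e0; apply: contrapT => H; suff : outer Y + e <= outer Y by lra.
apply: outer_ge => U Uo YU; rewrite leNgt; apply/negP => ?; apply: H.
by exists U.
Qed.

Lemma outer_ge0 Y : 0 <= outer Y.
Proof. by apply: outer_ge => U _ _; exact: inner_ge0. Qed.

Lemma outer_mono Y Z : Y `<=` Z -> outer Y <= outer Z.
Proof. by move=> YZ; apply: outer_ge => U Uo ZU; apply: outer_le => // x /YZ /ZU. Qed.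

Lemma mean_outer A : closed A -> m A <= outer A.
Proof. by move=> Ac; apply: outer_ge => U _; exact: inner_ge. Qed.

Lemma outer_mean B : open B -> outer B <= m B.
Proof.
move=> Bo; apply: le_trans (outer_le Bo (@subset_refl _ B)) _.
by apply: inner_le => C _; exact: (mean_le mm).
Qed.

(** The closed set [C] is cut into the parts where [p <= q] and where [q <= p]. As [p] is positive
    on [V] and [q] vanishes on [C] outside [U], the first part lies in [U]; likewise the second lies
    in [V]. *)
Lemma innerU U V : open U -> open V -> inner (U `|` V) <= inner U + inner V.
Proof.
move=> Uo Vo; apply: inner_le => C Cc CUV.
have [p [pc p0 pP]] := open_positive_function X_metrizable (openU Vo (closed_openC Cc)).
have [q [qc q0 qP]] := open_positive_function X_metrizable (openU Uo (closed_openC Cc)).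
have cl f g : continuous f -> continuous g -> closed (C `&` [set x | f x <= g x :> R]).
  move=> fc gc; apply: closedI => //.
  have -> : [set x | f x <= g x] = (fun x => g x - f x) @^-1` [set y | 0 <= y].
    by apply/seteqP; split=> x /=; rewrite subr_ge0.
  apply: closed_comp => [x _|]; last exact: closed_ge.
  by apply: cvgB; [exact: gc|exact: fc].
apply: (@le_trans _ _ (m (C `&` [set x | p x <= q x]) + m (C `&` [set x | q x <= p x]))).
  apply: le_trans (meanU_le mm _ _); apply: (mean_le mm) => x Cx.
  by have [|/ltW] := leP (p x) (q x); [left|right].
apply: lerD; apply: inner_ge (cl _ _ _ _) _ => // x [Cx /= le_pq].
- have [//|Vx] := CUV x Cx.
  have : 0 < q x by apply: lt_le_trans le_pq; apply/pP; left.
  by move/qP => [].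
- have [Ux|//] := CUV x Cx.
  have : 0 < p x by apply: lt_le_trans le_pq; apply/qP; left.
  by move/pP => [].
Qed.

(** A closed subset of the union is compact, so finitely many [U n] cover it and [innerU]
    applies. *)
Lemma inner_bigcup (U : nat -> set X) (r : R) : (forall n, open (U n)) ->
  (forall n, \sum_(i < n) inner (U i) <= r) -> inner (\bigcup_n U n) <= r.
Proof.
move=> Uo Ur; apply: inner_le => C Cc CU.
have [|x|s sP] := @compact_finite_subcover X nat (fun n => U n `|` ~` C) X_compact.
- by move=> n; apply: openU => //; exact: closed_openC.
- by have [/CU[n _ Un]|] := pselect (C x); [exists n; left|exists 0%N; right].
pose N := (\max_(i <- s) i).+1; apply: le_trans (Ur N).
have CN : C `<=` \big[setU/set0]_(i < N) U i.
  move=> x Cx; have [i si [Ui|//]] := sP x.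
  rewrite -bigcup_mkord; exists i => //=; rewrite ltnS.
  exact: (leq_bigmax_seq (F := id)).
apply: le_trans (inner_ge Cc CN) _; elim: N {CN} => [|N IH].
  rewrite !big_ord0; apply: inner_le => D _ /(mean_le mm).
  by rewrite (mean_set0 mm).
rewrite !big_ord_recr /=; apply: le_trans (innerU _ (Uo _)) _; last by rewrite lerD2r.
by rewrite -bigcup_mkord; apply: bigcup_open => i _.
Qed.

Lemma outer_sigma_subadditive : sigma_subadditive (fun Y => (outer Y)%:E).
Proof.
move=> F; apply/lee_addgt0Pr => e e0.
have /choice[U UP] n : exists U, [/\ open U, F n `<=` U &
    inner U < outer (F n) + e / (2 ^ n.+1)%:R].
  by apply: outer_adherent; rewrite divr_gt0 // ltr0n expn_gt0.
have FU : outer (\bigcup_n F n) <= inner (\bigcup_n U n).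
  apply: outer_le; first by apply: bigcup_open => i _; have [] := UP i.
  by move=> x [n _ Fn]; exists n => //; have [_ h _] := UP n; exact: h.
have := @epsilon_trick R (fun n => (outer (F n))%:E) e xpredT.
move=> /(_ (fun n => outer_ge0 _) (ltW e0)); apply: le_trans.
set S := (X in (_ <= X)%E).
have S0 n : ((\sum_(i < n) inner (U i))%:E <= S)%E.
  rewrite -sumEFin -(big_mkord xpredT (fun i => (inner (U i))%:E)).
  apply: le_trans (nneseries_lim_ge n _) => [|i _ _]; last first.
    by rewrite lee_fin addr_ge0 ?outer_ge0 // divr_ge0 // ltW.
  apply: lee_sum => i _; rewrite lee_fin; apply: ltW; have [_ _] := UP i; exact.
case: S S0 => [r h|_|/(_ 0%N)]; first by rewrite lee_fin; apply: le_trans FU _;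
  apply: inner_bigcup => [n|n]; [have [] := UP n|have := h n; rewrite lee_fin].
- by rewrite leey.
- by rewrite big_ord0.
Qed.

Lemma outer_set0 : outer set0 = 0.
Proof.
by apply/eqP; rewrite eq_le outer_ge0 andbT -(mean_set0 mm) outer_mean //; exact: open0.
Qed.

(** For closed [C] in the part of [V] inside [U] and closed [D] in [V] outside [C], the mean of the
    disjoint union is at most [inner V]; take suprema over [D], then over [C]. *)
Lemma outer_caratheodory U : open U -> forall Y, 
  outer (Y `&` U) + outer (Y `&` ~` U) <= outer Y.
Proof.
move=> Uo Y; apply: outer_ge => V Vo YV.
rewrite -lerBrDr; apply: le_trans (outer_le (openI Vo Uo) _) _.
  by move=> x [/YV].
apply: inner_le => C Cc CVU; rewrite lerBrDr -lerBrDl.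
apply: le_trans (outer_le (U := V `&` ~` C) _ _) _.
- exact: openI (closed_openC Cc).
- by move=> x [/YV Vx nU]; split=> // /CVU[].
apply: inner_le => D Dc DV; rewrite lerBrDl -(meanU mm); last first.
  by move=> x Cx /DV[].
by apply: inner_ge; [exact: closedU|move=> x [/CVU[]|/DV[]]].
Qed.

Lemma outer_act_le g Y : outer (a g @^-1` Y) <= outer Y.
Proof.
apply: outer_ge => U Uo YU; apply: le_trans (outer_le (open_preimage_act ha g Uo) _) _.
  by move=> x /YU.
apply: inner_le => C Cc CU; rewrite -(mean_act mm g^-1); apply: inner_ge.
  by apply: closed_comp => // x _; exact: (act_continuous ha).
by move=> x /CU /=; rewrite act_mulKV.
Qed.

Lemma outer_act g Y : outer (a g @` Y) = outer Y.
Proof.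
apply/eqP; rewrite eq_le (act_image ha) outer_act_le /=.
rewrite -[in leLHS](_ : a g @^-1` (a g^-1 @^-1` Y) = Y) ?outer_act_le //.
by apply/seteqP; split=> x /=; rewrite act_mulK.
Qed.

Let nu (Y : set X) : \bar R := (outer Y)%:E.

HB.instance Definition _ := isOuterMeasure.Build R X nu
  (congr1 EFin outer_set0) outer_ge0 outer_mono outer_sigma_subadditive.

Lemma borel_caratheodory (x0 : X) (E : set (borel x0)) : measurable E ->
  caratheodory_measurable nu E.
Proof.
move: E; apply: smallest_sub; first split.
- exact: caratheodory_measurable_set0.
- by move=> E hE; rewrite setTD; exact: caratheodory_measurable_setC.
- exact: caratheodory_measurable_bigcup.
- by move=> U Uo; apply: le_caratheodory_measurable => Y; rewrite -EFinD lee_fin outer_caratheodory.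
Qed.

Lemma mean_measure (x0 : X) : exists mu : probability (borel x0) R,
  [/\ is_invariant_measure a mu, forall A, closed A -> ((m A)%:E <= mu A)%E &
   forall B, open B -> (mu B <= (m B)%:E)%E].
Proof.
pose mu : set (borel x0) -> \bar R := nu.
have mu_sa : semi_sigma_additive mu.
  move=> F mF tF mUF.
  apply: (@caratheodory_measure_sigma_additive R (pointed_at x0) nu F) => //.
  - by move=> n; exact: (@borel_caratheodory x0).
  - exact: (@borel_caratheodory x0).
pose M := isMeasure.Build _ (borel x0) R mu (outer_measure0 nu) (outer_measure_ge0 nu) mu_sa.
pose mu1 : {measure set (borel x0) -> \bar R} := HB.pack mu M.
have mu_T : mu1 setT = 1%E.
  rewrite /mu1 /= /mu /nu; congr EFin; apply/eqP; rewrite eq_le.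
  have := outer_mean openT; have := mean_outer closedT.
  by rewrite (mean_setT mm) => -> ->.
pose P := Measure_isProbability.Build _ (borel x0) R mu1 mu_T.
pose mu2 : probability (borel x0) R := HB.pack mu M P.
exists mu2; split.
- by move=> g E _; rewrite /mu2 /= /mu /nu outer_act.
- by move=> A Ac; rewrite lee_fin mean_outer.
- by move=> B Bo; rewrite lee_fin outer_mean.
Qed.

End MeasureOfMean.

(** * Comparison *)

Section PartialSums.
Variables (R : realType) (T : eqType).

Definition psum (D : seq T) (F : T -> R) n := \sum_(s <- take n D) F s.

Lemma psum0 D F : psum D F 0 = 0. Proof. by rewrite /psum take0 big_nil. Qed.

Lemma psum_size D F : psum D F (size D) = \sum_(s <- D) F s.
Proof. by rewrite /psum take_size. Qed.

Lemma psum_index D F s : s \in D ->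
  psum D F (index s D).+1 = psum D F (index s D) + F s.
Proof.
move=> sD; rewrite /psum (take_nth s) ?index_mem // -cats1 big_cat /= big_seq1.
by rewrite nth_index.
Qed.

Lemma psum_mono D F m n : (forall s, 0 <= F s) -> (m <= n)%N -> psum D F m <= psum D F n.
Proof.
move=> F0 mn; rewrite /psum -(subnKC mn) takeD big_cat /= lerDl.
by apply: sumr_ge0.
Qed.

Lemma psum_crossing D F p : uniq D -> 0 <= p -> p < \sum_(s <- D) F s ->
  exists2 t, t \in D & psum D F (index t D) <= p < psum D F (index t D) + F t.
Proof.
move=> D_uniq p0; rewrite -psum_size => pD.
have ex : exists n, p < psum D F n by exists (size D).
case: (ex_minnP ex) => -[|n] pn nmin; first by move: pn; rewrite psum0 ltNge p0.
have nD : (n < size D)%N by exact: leq_trans (nmin _ pD).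
have /hasP[t0 _ _] : has predT D by rewrite has_predT; exact: leq_ltn_trans nD.
exists (nth t0 D n); first exact: mem_nth.
rewrite -psum_index ?mem_nth // index_uniq // pn andbT leNgt.
by apply/negP => /nmin; rewrite ltnn.
Qed.

Lemma psum_interval_inj D F q s s' : (forall s, 0 <= F s) -> s \in D -> s' \in D ->
  psum D F (index s D) < q < psum D F (index s D) + F s ->
  psum D F (index s' D) < q < psum D F (index s' D) + F s' -> s = s'.
Proof.
move=> F0; wlog ss : s s' / (index s D <= index s' D)%N.
  by move=> H sD sD' h h'; case/orP: (leq_total (index s D) (index s' D)) => ss;
    [exact: H|apply/esym; exact: H].
move=> sD sD' /andP[_ qs] /andP[qs' _]; move: ss; rewrite leq_eqVlt => /orP[/eqP ss|ss].
  by rewrite -(nth_index s sD) ss nth_index.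
have := psum_mono D F0 ss; rewrite psum_index // => h; exfalso.
by have := lt_trans qs' qs; rewrite ltNge h.
Qed.

End PartialSums.

(** By induction: the group is infinite, so a new element exists outside the finitely many products
    of [M] and its inverses with the earlier elements. *)
Lemma separated_elements (G : groupType) (M : {fset G}) k : countably_infinite G ->
  exists d : nat -> G, forall i j, (i < k)%N -> (j < k)%N -> i != j ->
    (d j * (d i)^-1)%g \notin M.
Proof.
move=> G_count; elim: k => [|k [d IH]]; first by exists (fun=> 1%g).
pose N := ([fset m * d i | m in M, i in iota 0 k]
  `|` [fset m^-1 * d i | m in M, i in iota 0 k])%fset%g.
have [y yN] : exists y, y \notin N.
  have [L LN] := infinite_fset #|` N|.+1 G_count.
  apply: contrapT => H; have /fsubset_leq_card : (L `<=` N)%fset; last by rewrite LN ltnn.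
  by apply/fsubsetP => y _; apply: contrapT => /negP yN; apply: H; exists y.
move: yN; rewrite in_fsetU negb_or => /andP[yN1 yN2].
exists (fun i => if i == k then y else d i) => i j ik jk ij.
have [ei|ni] := eqVneq i k; have [ej|nj] := eqVneq j k.
- by rewrite ei ej eqxx in ij.
- apply: contra yN2 => h; apply/imfset2P; exists (d j * y^-1)%g => //=.
  exists j; last by rewrite invgM invgK -mulgA mulVg mulg1.
  by rewrite mem_iota /=; lia.
- apply: contra yN1 => h; apply/imfset2P; exists (y * (d i)^-1)%g => //=.
  exists i; last by rewrite -mulgA mulVg mulg1.
  by rewrite mem_iota /=; lia.
- by apply: IH => //; lia.
Qed.

(** As [K] contains 1, the intersection lies in [S]; it is finite and [counting] is its number of
    elements. *)
Lemma invariant_shape_core (R : realType) (G : groupType) (K : {fset G}) (e : R) (S : {fset G}) :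
  1%g \in K -> is_invariant_shape K e S ->
  exists S' : {fset G}, [/\ (S' `<=` S)%fset, (1 - e) * #|` S|%:R < #|` S'|%:R &
    forall g t, g \in K -> t \in S' -> (g^-1 * t)%g \in S].
Proof.
move=> K1; rewrite /is_invariant_shape.
set C := \bigcap_(g in _) _ => lt.
have CS : C `<=` [set` S].
  by move=> t /(_ _ K1)[s sS <-]; rewrite /= mul1g.
have Cfin : finite_set C by apply: sub_finite_set CS _; exact: finite_fset.
exists (fset_set C); split.
- by apply/fsubsetP => t; rewrite in_fset_set // inE => /CS.
- by move: lt; rewrite /counting asboolT // lte_fin.
- move=> g t gK; rewrite in_fset_set // inE => /(_ _ gK)[s sS <-].
  by rewrite mulKg.
Qed.

Section Comparison.
Variables (R : realType) (G : groupType) (X : topologicalType) (a : G -> X -> X).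
Hypothesis G_count : countably_infinite G.
Hypothesis G_FC : FC_group G.
Hypothesis X_compact : compact [set: X].
Hypothesis X_metrizable : metrizable R X.
Hypothesis ha : acts_by_homeomorphisms a.
Hypothesis a_free : is_free_action a.

(** Otherwise each Folner set has a point from which it visits [B] at most as often as [A]. A limit
    mean then has [m B <= m A], and its regularization satisfies [mu B <= m B <= m A <= mu A]. *)
Lemma uniform_visits (A B : set X) : closed A -> open B ->
  (forall (x0 : X) (mu : probability (borel x0) R),
     is_invariant_measure a mu -> (mu A < mu B)%E) ->
  exists E : {fset G}, forall x, (#|` visits a E x A| < #|` visits a E x B|)%N.
Proof.
move=> Ac Bo AB; apply: contrapT => H.
have [E [E0 EF]] := Folner_sequence R G_count G_FC.
have /choice[x xP] n : exists x, (#|` visits a (E n) x B| <= #|` visits a (E n) x A|)%N.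
  apply: contrapT => Hn; apply: H; exists (E n) => x; rewrite ltnNge; apply/negP => ?.
  by apply: Hn; exists x.
have [m [mm _ mE]] := mean_exists ha x E0 EF.
have [mu [mu_inv muA muB]] := mean_measure X_compact X_metrizable ha mm (x 0%N).
have mBA : m B <= m A.
  by apply: mE => n; rewrite ler_wpM2r ?invr_ge0 // ler_nat.
have := AB _ _ mu_inv; rewrite ltNge => /negP; apply.
by apply: le_trans (muB _ Bo) _; apply: le_trans (muA _ Ac); rewrite lee_fin.
Qed.

Lemma visits_sum E x A : #|` visits a E x A|%:R = \sum_(g <- E) (`[< A (a g x) >])%:R :> R.
Proof.
rewrite (card_fset_sum_mem (B := E)); last by apply/fsubsetP => g /visitsP[].
rewrite natr_sum big_seq [RHS]big_seq; apply: eq_bigr => g gE.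
by rewrite in_fset_sep gE.
Qed.

End Comparison.

Section RealFunctions.
Variables (R : realType) (X : topologicalType).

Definition pos_part (u : R) : R := Num.max 0 u.

Lemma pos_part_ge0 u : 0 <= pos_part u. Proof. by rewrite le_max lexx. Qed.

Lemma pos_part_ge u : u <= pos_part u. Proof. by rewrite le_max lexx orbT. Qed.

Lemma pos_part_le u v : 0 <= v -> u <= v -> pos_part u <= v.
Proof. by move=> v0 uv; rewrite ge_max v0. Qed.

Lemma pos_part_mono u v : u <= v -> pos_part u <= pos_part v.
Proof. by move=> uv; apply: pos_part_le; [exact: pos_part_ge0|exact: le_trans (pos_part_ge v)]. Qed.

Lemma continuous_pos_part (u : X -> R) : continuous u -> continuous (pos_part \o u).
Proof.
move=> uc; rewrite (_ : _ \o _ = fun x => 2^-1 * (u x + `|u x|)).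
  move=> x; apply: cvgM; first exact: cvg_cst.
  by apply: cvgD; [exact: uc|apply: cvg_norm; exact: uc].
apply/funext => x; rewrite /= /pos_part; case: (leP 0 (u x)) => ux.
  by rewrite ger0_norm //; lra.
by rewrite ltr0_norm // subrr mulr0.
Qed.

Lemma continuous_sumr (I : Type) (s : seq I) (F : I -> X -> R) :
  (forall i, continuous (F i)) -> continuous (fun x => \sum_(i <- s) F i x).
Proof.
move=> Fc; elim: s => [|i s IH].
  rewrite (_ : (fun x => _) = fun=> 0); first exact: cst_continuous.
  by apply/funext => x; rewrite big_nil.
rewrite (_ : (fun x => _) = fun x => F i x + \sum_(j <- s) F j x).
  by move=> x; apply: cvgD; [exact: Fc|exact: IH].
by apply/funext => x; rewrite big_cons.
Qed.

Lemma open_lt_continuous (u v : X -> R) : continuous u -> continuous v ->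
  open [set x | u x < v x].
Proof.
move=> uc vc; rewrite (_ : mkset _ = (fun x => v x - u x) @^-1` [set y | 0 < y]).
  apply: open_comp; last exact: open_gt.
  by move=> x _; apply: cvgB; [exact: vc|exact: uc].
by apply/seteqP; split=> x /=; rewrite subr_gt0.
Qed.

End RealFunctions.

Section Comparison.
Variables (R : realType) (G : groupType) (X : topologicalType) (a : G -> X -> X).
Hypothesis G_count : countably_infinite G.
Hypothesis G_FC : FC_group G.
Hypothesis X_compact : compact [set: X].
Hypothesis X_metrizable : metrizable R X.
Hypothesis ha : acts_by_homeomorphisms a.
Hypothesis a_free : is_free_action a.

Lemma continuous_act (u : X -> R) g : continuous u -> continuous (fun x => u (a g x)).
Proof.
by move=> uc x; apply: (@continuous_comp _ _ _ (a g) u); [exact: (act_continuous ha)|exact: uc].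
Qed.

(** As [k] grows, [f k] decreases to the indicator of [A] and [h k] increases to that of [B]. At
    each point the sums exceed 1/2 from some [k] on; being monotone in [k], they do so uniformly by
    compactness. *)
Lemma gap_functions (A B : set X) (E : {fset G}) : closed A -> open B ->
  (forall x, (#|` visits a E x A| < #|` visits a E x B|)%N) ->
  exists f h : X -> R, [/\ continuous f /\ continuous h,
    forall z, 0 <= f z <= 1 /\ 0 <= h z <= 1,
    forall z, A z -> f z = 1, forall z, 0 < h z -> B z &
    forall x, 2^-1 <= \sum_(g <- E) (h (a g x) - f (a g x))].
Proof.
move=> Ac Bo AB.
have [p [pc p0 pP]] := open_positive_function X_metrizable (closed_openC Ac).
have [q [qc q0 qP]] := open_positive_function X_metrizable Bo.
pose f (k : nat) z : R := pos_part (1 - k%:R * p z).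
pose h (k : nat) z : R := 1 - pos_part (1 - k%:R * q z).
have scale_c (r : X -> R) (k : nat) : continuous r -> continuous (fun z => 1 - k%:R * r z).
  move=> rc z; apply: cvgB; first exact: cvg_cst.
  by apply: cvgM; [exact: cvg_cst|exact: rc].
have fc k : continuous (f k) by exact: continuous_pos_part (scale_c _ _ pc).
have hc k : continuous (h k).
  move=> z; apply: cvgB; first exact: cvg_cst.
  exact: (continuous_pos_part (scale_c _ k qc)).
have mono (r : X -> R) j k z : 0 <= r z -> (j <= k)%N ->
    pos_part (1 - k%:R * r z) <= pos_part (1 - j%:R * r z).
  by move=> r0 jk; apply: pos_part_mono; rewrite lerB // ler_wpM2r // ler_nat.
have vanish (r : X -> R) z : 0 < r z -> exists k : nat, pos_part (1 - k%:R * r z) = 0.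
  move=> r0; exists (Num.bound (r z)^-1); apply/eqP; rewrite eq_le pos_part_ge0 andbT.
  apply: pos_part_le => //; rewrite subr_le0 -ler_pdivrMr // mul1r ltW //.
  by apply: archi_boundP; rewrite invr_ge0 ltW.
have u_mono j k z : (j <= k)%N -> h j z - f j z <= h k z - f k z.
  by move=> jk; have := mono p j k z (p0 z) jk; have := mono q j k z (q0 z) jk; rewrite /h /f; lra.
have vanish2 (P : Prop) (r : X -> R) z : (0 < r z <-> P) -> 0 <= r z ->
    exists k : nat, pos_part (1 - k%:R * r z) <= (`[< ~ P >])%:R.
  move=> rP r0; have [/rP rz|nP] := pselect P.
    by have [k kr] := vanish _ _ rz; exists k; rewrite kr.
  exists 0%N; rewrite mul0r subr0; apply: pos_part_le => //.
  by rewrite asboolT.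
have point z : exists k, (`[< B z >])%:R - (`[< A z >])%:R <= h k z - f k z.
  have [i hi] := vanish2 _ _ z (pP z) (p0 z); have [j hj] := vanish2 _ _ z (qP z) (q0 z).
  exists (maxn i j); have := mono p i _ z (p0 z) (leq_maxl i j).
  have := mono q j _ z (q0 z) (leq_maxr i j).
  move: hi hj; rewrite /h /f /= !asbool_neg negbK; case: `[< A z >]; case: `[< B z >] => /=; lra.
have {}point x : exists k, 1 <= \sum_(g <- E) (h k (a g x) - f k (a g x)).
  have /choice[k kP] g := point (a g x).
  exists (\max_(g <- E) k g)%N.
  have : 1 <= #|` visits a E x B|%:R - #|` visits a E x A|%:R :> R.
    by have := AB x; rewrite -(ler_nat R) -natr1; lra.
  rewrite !visits_sum -sumrB => /le_trans; apply.
  rewrite big_seq [leRHS]big_seq; apply: ler_sum => g gE.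
  by apply: le_trans (kP g) _; apply: u_mono; exact: leq_bigmax_seq.
pose S k x := \sum_(g <- E) (h k (a g x) - f k (a g x)).
have [|x|s sP] := @compact_finite_subcover X nat (fun k => [set x | 2^-1 < S k x]) X_compact.
- move=> k; apply: open_lt_continuous; first exact: cst_continuous.
  apply: continuous_sumr => g x; apply: cvgB.
    exact: continuous_act (hc k) x.
  exact: continuous_act (fc k) x.
- by have [k k1] := point x; exists k => /=; apply: lt_le_trans k1; lra.
pose k := (\max_(i <- s) i)%N; exists (f k), (h k); split.
- by split.
- move=> z; have := pos_part_ge0 (1 - k%:R * p z); have := pos_part_ge0 (1 - k%:R * q z).
  have := mono p 0%N k z (p0 z) (leq0n k); have := mono q 0%N k z (q0 z) (leq0n k).
  rewrite !mul0r subr0 (_ : pos_part 1 = 1); last by rewrite /pos_part max_r ?ler01.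
  by rewrite /h /f => q1 p1 q2 p2; split; apply/andP; split; lra.
- move=> z Az; rewrite /f (_ : p z = 0); first by rewrite mulr0 subr0 /pos_part max_r ?ler01.
  apply/eqP; rewrite eq_le p0 andbT leNgt; apply/negP => /pP; exact.
- move=> z hz; apply/qP; rewrite lt_neqAle q0 andbT eq_sym; apply: contraTneq hz => qz.
  by rewrite /h qz mulr0 subr0 /pos_part max_r ?ler01 // subrr ltxx.
- move=> x; have [i si] := sP x => /ltW; move/le_trans; apply.
  by apply: ler_sum => g _; apply: u_mono; exact: (leq_bigmax_seq (F := id)).
Qed.

End Comparison.

Lemma ler_sum_fsubset (R : realType) (T : choiceType) (A B : {fset T}) (F : T -> R) :
  (A `<=` B)%fset -> (forall s, 0 <= F s) -> \sum_(s <- A) F s <= \sum_(s <- B) F s.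
Proof.
move=> /fsubsetP AB F0; rewrite [leRHS](bigID (mem A)) /= -[X in _ <= X + _]big_filter.
rewrite [X in _ <= X + _](perm_big (enum_fset A)) ?lerDl ?sumr_ge0 //.
apply: uniq_perm; rewrite ?filter_uniq ?fset_uniq // => s.
by rewrite mem_filter /=; case: (boolP (s \in A)) => //= /AB.
Qed.

Lemma sumr_const_size (R : realType) (T : Type) (s : seq T) (c : R) :
  \sum_(i <- s) c = (size s)%:R * c.
Proof.
by rewrite mulr_natl big_const_seq count_predT; elim: (size s) => [|n IH]; rewrite ?mulrS /= ?IH.
Qed.

Lemma ler_sum_mem (R : realType) (T : eqType) (s : seq T) (F : T -> R) i :
  i \in s -> (forall j, 0 <= F j) -> F i <= \sum_(j <- s) F j.
Proof. by move=> si F0; rewrite (big_rem i) //= lerDl sumr_ge0. Qed.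

Section Comparison.
Variables (R : realType) (G : groupType) (X : topologicalType) (a : G -> X -> X).
Hypothesis ha : acts_by_homeomorphisms a.

(** Sum [u] over the pairs of [g] in [E] and [t] in the interior [S']. Each [t] contributes at least
    1/2. For each [g] the points [g * t] fill a part of [S], and [u >= -1] bounds what the small
    rest of [S] can take away. *)
Lemma invariant_sum_ge (u : X -> R) (K E S : {fset G}) x :
  (forall z, -1 <= u z) -> (forall x, 2^-1 <= \sum_(g <- E) u (a g x)) ->
  1%g \in K -> (forall g, g \in E -> (g^-1)%g \in K) -> E != fset0 ->
  is_invariant_shape K ((8 * #|` E|)%:R^-1 : R) S ->
  #|` S|%:R <= 4 * #|` E|%:R * \sum_(s <- S) u (a s x).
Proof.
move=> u1 uE K1 EK E0 /invariant_shape_core[//|S' [SS card_S' S'K]].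
have en0 : 0 < #|` E|%:R :> R by rewrite ltr0n cardfs_gt0.
set n := #|` E|%:R in en0 *; set w := \sum_(s <- S) _.
have main g : g \in E -> \sum_(t <- S') u (a g (a t x)) <= w + #|` S|%:R - #|` S'|%:R.
  move=> gE; pose T := [fset (g * t)%g | t in S']%fset.
  have TS : (T `<=` S)%fset.
    by apply/fsubsetP => _ /imfsetP[t /= tS' ->]; have := S'K _ _ (EK _ gE) tS'; rewrite invgK.
  have := @ler_sum_fsubset R _ _ _ (fun s => u (a s x) + 1) TS.
  rewrite !big_split /= !sumr_const_size !mulr1 -/w card_fset_image; last exact: mulgI.
  rewrite big_imfset /=; last by move=> ? ? _ _; exact: mulgI.
  rewrite (eq_bigr (fun t => u (a g (a t x)))); last by move=> t _; rewrite (actM ha).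
  move=> h; suff : \sum_(t <- S') u (a g (a t x)) + #|` S'|%:R <= w + #|` S|%:R by lra.
  by apply: h => z; have := u1 (a z x); lra.
have sum_main : #|` S'|%:R * 2^-1 <= n * (w + #|` S|%:R - #|` S'|%:R).
  have -> : n * (w + #|` S|%:R - #|` S'|%:R) = \sum_(g <- E) (w + #|` S|%:R - #|` S'|%:R).
    by rewrite sumr_const_size.
  rewrite (_ : _ * _ = \sum_(t <- S') 2^-1); last first.
    by rewrite sumr_const_size.
  apply: (@le_trans _ _ (\sum_(t <- S') \sum_(g <- E) u (a g (a t x)))).
    by apply: ler_sum => t _; exact: uE.
  rewrite exchange_big /= big_seq [leRHS]big_seq; apply: ler_sum => g; exact: main.
have n8 : n * (8 * #|` E|)%:R^-1 = 8^-1 :> R.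
  by rewrite natrM invfM mulrCA divff ?mulr1 // gt_eqF.
have e8 : (8 * #|` E|)%:R^-1 <= 8^-1 :> R.
  by rewrite lef_pV2 ?posrE ?ltr0n ?muln_gt0 ?cardfs_gt0 // ler_nat leq_pmulr // cardfs_gt0.
move: card_S' sum_main n8 e8; set e := (_)^-1; set s := #|` S|%:R; set s' := #|` S'|%:R.
have s0 : 0 <= s by [].
nra.
Qed.

(** Each point of [U] is sent into [W] by some [g] of [L]; the images for different [g] are disjoint
    by freeness. *)
Lemma lfree_subequivalent (L : {fset G}) (U W : set X) : open U -> open W ->
  is_lfree a L U -> (forall x, exists2 g, g \in L & W (a g x)) -> is_subequivalent a U W.
Proof.
move=> Uo Wo LU LW.
apply: (@subequivalentI _ _ _ L (fun g => U `&` a (val g) @^-1` W) val).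
- by move=> g; apply: openI => //; exact: open_preimage_act.
- by move=> x Ux; have [g gL Wg] := LW x; exists [` gL]%fset.
- move=> g h x y [Ux _] [Uy _] e; apply: val_inj; apply: LU; rewrite /= ?fsvalP //.
  by exists (a (val g) x); split; [exists x|rewrite e; exists y].
- by move=> g x [].
Qed.

Lemma small_subequivalent (U : set X) (W : nat -> set X) k (Q : set X) :
  (forall i, (i < k)%N -> is_subequivalent a U (W i)) ->
  (forall i j z, (i < k)%N -> (j < k)%N -> W i z -> W j z -> i = j) ->
  small a U k Q -> is_subequivalent a Q [set z | exists2 i, (i < k)%N & W i z].
Proof.
elim: k Q => [|k IH] Q UW dis /=.
  move=> Q0; exists 0%N, (fun=> set0), (fun=> 1%g); split; try by case.
  by move=> x /Q0.
case=> Q1 [Q2 [QQ Q1U sQ2]].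
apply: (@subequivalent_sub _ _ _ (Q1 `|` Q2) _
  (W k `|` [set z | exists2 i, (i < k)%N & W i z])) => //.
  by move=> z [Wk|[i ik Wi]]; [exists k|exists i => //; exact: ltnW].
apply: subequivalentU.
- move=> z Wk [i ik Wi]; have e := dis i k z (ltnW ik) (ltnSn k) Wi Wk.
  by rewrite e ltnn in ik.
- by apply: (subequivalent_trans ha Q1U); exact: UW.
- apply: IH => // [i ik|i j z ik jk]; first by apply: UW; exact: ltnW.
  by apply: dis; exact: ltnW.
Qed.

Lemma continuous_psum (F : X -> R) (D : seq G) n : continuous F ->
  continuous (fun x => psum D (fun s => F (a s x)) n).
Proof.
move=> Fc; apply: (continuous_sumr (F := fun s x => F (a s x))) => s.
exact: (continuous_act ha Fc).
Qed.

(* In a tower the masses of [f] and [h] are laid out along a line: a point is sent to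
   the first level at which the partial sums of [h] exceed those of [f]. *)
Lemma castle_subequivalent (A : set X) (V : {fset G} -> set X) (B : {fset G})
    (f h : X -> R) (l : R) :
  (forall D, V D !=set0 -> (D `<=` B)%fset) -> (forall D, open (V D)) ->
  (forall D D' g g' x x', V D x -> V D' x' -> g \in D -> g' \in D' ->
      a g x = a g' x' -> D = D' /\ g = g') ->
  continuous f -> continuous h -> (forall z, 0 <= f z) -> (forall z, 0 <= h z <= l) -> l < 1 ->
  (forall z, A z -> f z = 1) ->
  (forall D x, V D x -> \sum_(s <- D) f (a s x) <= \sum_(s <- D) h (a s x)) ->
  is_subequivalent a (A `&` \bigcup_D levels a D (V D)) [set z | 0 < h z].
Proof.
move=> VB Vo Vdis fc hc f0 hl l1 fA fh.
(* The interval of [s] for [f] starts at [P D s x] and has length [f (a s x)]; the interval of [t]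
   for [h] ends at [Q D t x]. *)
pose P (D : {fset G}) (s : G) x := psum D (fun r => f (a r x)) (index s D).
pose Q (D : {fset G}) (t : G) x := psum D (fun r => h (a r x)) (index t D).+1.
pose J := (fpowerset B * B * B)%type.
pose T (j : J) : set X := let: (D, s, t) := j in
  [set x | [/\ val s \in val D, val t \in val D, V (val D) x,
     P (val D) (val s) x < Q (val D) (val t) x < P (val D) (val s) x + f (a (val s) x) &
     0 < h (a (val t) x)]].
have To j : open (T j).
  case: j => -[D s] t; have [sD|sD] := boolP (val s \in val D); last first.
    by rewrite (_ : T _ = set0); [exact: open0|apply/seteqP; split=> x // -[]; rewrite (negbTE sD)].
  have [tD|tD] := boolP (val t \in val D); last first.
    rewrite (_ : T _ = set0); first exact: open0.
    by apply/seteqP; split=> x // -[_]; rewrite (negbTE tD).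
  rewrite (_ : T _ = V (val D) `&` [set x | P (val D) (val s) x < Q (val D) (val t) x] `&`
    [set x | Q (val D) (val t) x < P (val D) (val s) x + f (a (val s) x)] `&`
    [set x | 0 < h (a (val t) x)]); last first.
    by apply/seteqP; split=> x [] => [_ _ Vx /andP[]|[[]]] *; split=> //; apply/andP.
  have Pc : continuous (P (val D) (val s)) by exact: continuous_psum.
  have Qc : continuous (Q (val D) (val t)) by exact: continuous_psum.
  do 3?apply: openI => //; apply: open_lt_continuous => //.
  - by move=> x; apply: cvgD; [exact: Pc|exact: (continuous_act ha fc)].
  - exact: cst_continuous.
  - exact: (continuous_act ha hc).
apply: (@subequivalentI _ _ _ J (fun j => a (val j.1.2)^-1%g @^-1` T j)
  (fun j => (val j.2 * (val j.1.2)^-1)%g)).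
- by move=> j; exact: open_preimage_act.
- move=> z [Az [D _ [s /= sD [x Vx sxz]]]].
  have DB : (D `<=` B)%fset by apply: VB; exists x.
  have P0 : 0 <= P D s x by apply: sumr_ge0.
  have Ps : P D s x + f (a s x) <= \sum_(r <- D) f (a r x).
    rewrite /P -psum_index // -psum_size; apply: psum_mono => //.
    by rewrite index_mem.
  have fsx : f (a s x) = 1 by rewrite sxz fA.
  have Ph : P D s x < \sum_(r <- D) h (a r x).
    by apply: lt_le_trans (fh _ _ Vx); apply: lt_le_trans Ps; rewrite fsx ltrDl.
  have [t tD /andP[Qt tQ]] := psum_crossing (fset_uniq D) P0 Ph.
  have DB' : D \in fpowerset B by rewrite fpowersetE.
  have BD r : r \in D -> r \in B by move/fsubsetP: DB; apply.
  exists ([` DB'], [` BD _ sD], [` BD _ tD])%fset; rewrite /= -sxz act_mulK //; split=> //=.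
    (* Since [h <= l < 1], the interval of [t] ends strictly inside that of [s], which has length 1;
       so the strict, open conditions of [T] hold. *)
    rewrite /Q psum_index // tQ /= fsx; have := hl (a t x); lra.
  by have := lt_le_trans tQ _; move=> /(_ _ (lerD Qt (lexx _))); rewrite ltrDl.
- move=> [[D s] t] [[D' s'] t'] z z' /= [sD tD Vx Px hx] [sD' tD' Vx' Px' hx'].
  rewrite !(actM ha) => e; have [DD tt] := Vdis _ _ _ _ _ _ Vx Vx' tD tD' e.
  move: e; rewrite -tt => /(can_inj (act_mulK ha _)) xx.
  rewrite -DD -tt -xx in sD' tD' Px' *.
  (* The images share [t], and the number [Q D t x] lies inside only one of the disjoint intervals
     for [f], which determines [s]. *)
  have ss := psum_interval_inj (fun _ => f0 _) sD sD' Px Px'.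
  by congr (_, _, _); exact: val_inj.
- by move=> [[D s] t] z /= [_ _ _ _ hx]; rewrite (actM ha).
Qed.

End Comparison.

(** The gap [sh - sf] is at least [2 * e * d]. One half pays for the reserve, as [n <= e * d], the
    other for the factor [1 - e], as [e * sh <= e * d]. *)
Lemma discounted_gap (R : realType) (n e d sh sf sh1 : R) : 1 <= n -> 0 < e <= 8^-1 ->
  n * e = 8^-1 -> d <= 4 * n * (sh - sf) -> sh <= d -> 8 * n * n <= d -> sh <= sh1 + n ->
  sf <= (1 - e) * sh1.
Proof.
move=> n1 /andP[e0 e8] ne gap hd nd loss.
have gap' : 2 * e * d <= sh - sf.
  have : 2 * e * d <= 2 * e * (4 * n * (sh - sf)) by rewrite ler_pM2l // mulr_gt0.
  by rewrite (_ : 2 * e * (4 * n * (sh - sf)) = 8 * (n * e) * (sh - sf)); [rewrite ne; lra|ring].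
have nd' : n <= e * d.
  have : e * (8 * n * n) <= e * d by rewrite ler_pM2l.
  by rewrite (_ : e * (8 * n * n) = 8 * (n * e) * n); [rewrite ne; lra|ring].
have : (1 - e) * (sh - n) <= (1 - e) * sh1 by rewrite ler_wpM2l //; lra.
have : e * sh <= e * d by rewrite ler_pM2l.
have : 0 <= e * n by rewrite mulrC ne; lra.
rewrite mulrBl mulrBr mul1r; lra.
Qed.

Section Comparison.
Variables (R : realType) (G : groupType) (X : topologicalType) (a : G -> X -> X).
Hypothesis G_count : countably_infinite G.
Hypothesis G_FC : FC_group G.
Hypothesis X_compact : compact [set: X].
Hypothesis X_metrizable : metrizable R X.
Hypothesis ha : acts_by_homeomorphisms a.
Hypothesis a_free : is_free_action a.
Hypothesis a_marker : marker_property a.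

(* The sets [W i] are kept for the complement of the castle. What they cost each orbit
   piece is [#|E|], independently of their number [k]. *)
Lemma reserve (B : set X) (h : X -> R) (E S0 : {fset G}) k : open B -> continuous h ->
  (forall z, 0 <= h z <= 1) -> (forall x, exists2 g, g \in E & B (a g x)) ->
  exists (h1 : X -> R) (W : nat -> set X) (L : {fset G}),
  [/\ continuous h1, forall z, 0 <= h1 z <= h z,
    forall i, [/\ open (W i), W i `<=` B & forall z, (i < k)%N -> W i z -> h1 z = 0],
    (forall i, (i < k)%N -> forall x, exists2 g, g \in L & W i (a g x)) /\
    (forall i j z, (i < k)%N -> (j < k)%N -> W i z -> W j z -> i = j) &
    forall S x, (S `<=` S0)%fset ->
      \sum_(s <- S) h (a s x) <= \sum_(s <- S) h1 (a s x) + #|` E|%:R].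
Proof.
move=> Bo hc h01 EB.
pose W0 := (1%g |` [fset (s' * s^-1)%g | s' in S0, s in S0])%fset.
pose M := [fset (p.1.1^-1 * p.2 * p.1.2)%g | p in
  [seq (u, w) | u <- [seq (e', e) | e' <- E, e <- E], w <- W0]]%fset.
have MP e e' w : e \in E -> e' \in E -> w \in W0 -> (e'^-1 * w * e)%g \in M.
  move=> eE eE' wW; apply/imfsetP; exists (e', e, w) => //=.
  by apply/allpairsP; exists ((e', e), w) => /=; split=> //; apply/allpairsP; exists (e', e).
have [d dP] := separated_elements M k G_count.
pose L0 := (1%g |` [fset ((d p.1.2)^-1 * p.2 * d p.1.1)%g | p in
  [seq (u, w) | u <- [seq (i, j) | i <- iota 0 k, j <- iota 0 k], w <- M]])%fset.
have L0P i j w : (i < k)%N -> (j < k)%N -> w \in M -> ((d j)^-1 * w * d i)%g \in L0.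
  move=> ik jk wM; rewrite /L0 in_fset1U; apply/orP; right; apply/imfsetP; exists (i, j, w) => //=.
  apply/allpairsP; exists ((i, j), w) => /=; split=> //.
  by apply/allpairsP; exists (i, j); rewrite /= !mem_iota.
(* [L0] is so large that the sets [a (e * d i) @` U] with different [i] are not met by
   the same [S x]; hence [S x] meets all of them together at most [#|E|] times. *)
have [U [[Uo UG] LU]] := a_marker L0.
have [phi [phic phi0 phiP]] := open_positive_function X_metrizable Uo.
(* The element [l] of [L0] takes the point [u] of [U] to [u'] in [U], so it is 1 by freeness; then
   [d j * (d i)^-1] lies in [M], which forces [i = j]. *)
have key i j e e' w u u' : (i < k)%N -> (j < k)%N -> e \in E -> e' \in E -> w \in W0 ->
    U u -> U u' -> a (e' * d j)%g u' = a (w * (e * d i))%g u ->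
    i = j /\ (e' * d j = w * (e * d i))%g.
  move=> ik jk eE eE' wW Uu Uu' eq.
  pose l := ((d j)^-1 * (e'^-1 * w * e) * d i)%g.
  have lu : a l u = u'.
    have := congr1 (a (e' * d j)^-1%g) eq; rewrite act_mulK // -(actM ha) => ->.
    by congr a; rewrite /l invgM !mulgA.
  have l1 : l = 1%g.
    apply: LU; rewrite /= ?L0P ?MP //; first by rewrite /L0 in_fset1U eqxx.
    by exists u'; split; [exists u|exists u' => //; rewrite (act1 ha)].
  have eq2 : (e' * d j = w * (e * d i))%g.
    have := congr1 (fun g => e' * d j * g)%g l1; rewrite mulg1 => <-.
    by rewrite /l !mulgA mulgK mulgV mul1g.
  split=> //; apply/eqP; apply: contraT => ij; move: (dP _ _ ik jk ij).
  rewrite (_ : (d j * (d i)^-1)%g = (e'^-1 * w * e)%g) ?MP //.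
  apply: (mulgI e'); apply: (mulIg (d i)); rewrite -!mulgA mulVg mulg1 eq2.
  by rewrite mulVKg.
have Ucov x : exists g, 0 < phi (a g x).
  have [g _ [y Uy <-]] : (\bigcup_g (a g @` U)) x by rewrite UG.
  by exists g^-1%g; rewrite act_mulK //; apply/phiP.
have [c [F [c0 FP]]] := marker_cover ha X_compact phic Ucov.
pose P := [seq (e * d i)%g | e <- E, i <- iota 0 k].
have PP e i : e \in E -> (i < k)%N -> (e * d i)%g \in P.
  by move=> eE ik; apply/allpairsP; exists (e, i); rewrite /= mem_iota.
pose rho z := \sum_(p <- P) phi (a p^-1%g z).
(* [h] is cut down to 0 where one of the translates of [phi] exceeds [c], in particular on the sets
   [W i] with [i < k], and is unchanged off the translates of [U]. *)
pose h1 z := pos_part (h z - c^-1 * rho z).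
pose W i := B `&` \bigcup_(e in [set` E]) [set z | c < phi (a (e * d i)^-1%g z)].
have rho0 z : 0 <= rho z by apply: sumr_ge0.
have rho_c : continuous rho.
  apply: (continuous_sumr (F := fun p x => phi (a p^-1%g x))) => p.
  exact: (continuous_act ha phic).
have cV0 : 0 <= c^-1 by rewrite invr_ge0 ltW.
exists h1, W, [fset (p * g)%g | p in P, g in F]%fset; split.
- apply: continuous_pos_part => z; apply: cvgB; first exact: hc.
  by apply: cvgM; [exact: cvg_cst|exact: rho_c].
- move=> z; rewrite pos_part_ge0 /=; apply: pos_part_le; first by case/andP: (h01 z).
  by rewrite gerBl mulr_ge0.
- move=> i; split.
  + apply: openI => //; apply: bigcup_open => e _; apply: open_lt_continuous.
      exact: cst_continuous.
    exact: (continuous_act ha phic).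
  + by move=> z [].
  + move=> z ik [_ [e eE /= cz]]; apply/eqP; rewrite eq_le pos_part_ge0 andbT.
    apply: pos_part_le => //; rewrite subr_le0; have /andP[_ h1z] := h01 z.
    apply: le_trans h1z _; rewrite mulrC ler_pdivlMr // mul1r; apply: le_trans (ltW cz) _.
    exact: (ler_sum_mem (F := fun p => phi (a p^-1%g z)) (PP _ _ eE ik)).
- split=> [i ik x|i j z ik jk [_ [e eE /= ez]] [_ [e' eE' /= ez']]].
    have [g gF gc] := FP x; have [e eE eB] := EB (a (d i) (a g x)).
    exists (e * d i * g)%g; first by apply/imfset2P; exists (e * d i)%g; [exact: PP|exists g].
    split; first by rewrite -mulgA !(actM ha).
    by exists e => //=; rewrite (actM ha (e * d i)%g) act_mulK.
  have [] := key i j e e' 1%g (a (e * d i)^-1%g z) (a (e' * d j)^-1%g z) ik jk eE eE' => //.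
  - by rewrite /W0 in_fset1U eqxx.
  - by apply/phiP; exact: lt_trans ez.
  - by apply/phiP; exact: lt_trans ez'.
  - by rewrite mul1g !act_mulKV.
- move=> S x SS.
  pose Y : set X := [set z | exists2 p, p \in P & U (a p^-1%g z)].
  have card_Y : (#|` visits a S x Y| <= #|` E|)%N.
    (* Each visit is assigned an [e] in [E] that witnesses it. By [key] this is injective, whatever
       the indices [i], so the bound does not involve [k]. *)
    have /choice[f fP] s : exists e, s \in visits a S x Y -> e \in E /\
        exists2 i, (i < k)%N & U (a (e * d i)^-1%g (a s x)).
      have [/visitsP[sS [p /allpairsP[[e i] /= [eE ik ->]] Up]]|_] := boolP (s \in visits a S x Y).
        by exists e => _; split=> //; exists i => //; rewrite mem_iota in ik.
      by exists 1%g.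
    have <- : #|` [fset f s | s in visits a S x Y]%fset| = #|` visits a S x Y|.
      apply: card_in_imfset => /= s s' sY sY'.
      have [eE [i ik Ui]] := fP _ sY; have [eE' [j jk Uj]] := fP _ sY'.
      move=> ff; rewrite -ff in eE' Uj.
      have sS : s \in S0 by case/visitsP: sY => sS _; exact: (fsubsetP SS).
      have sS' : s' \in S0 by case/visitsP: sY' => sS' _; exact: (fsubsetP SS).
      have [||ij ee] := key i j (f s) (f s) (s' * s^-1)%g _ _ ik jk eE eE _ Ui Uj.
      - by rewrite /W0 in_fset1U; apply/orP; right; apply/imfset2P; exists s' => //; exists s.
      - by rewrite (actM ha (s' * s^-1)%g) !act_mulKV // -(actM ha) mulgVK.
      - have : (1 * (f s * d i) = (s' * s^-1) * (f s * d i))%g by rewrite mul1g -ee ij.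
        by move/mulIg/(congr1 (fun g => g * s)%g); rewrite mul1g mulgVK.
    by apply/fsubset_leq_card/fsubsetP => _ /imfsetP[s /= sY ->]; case: (fP _ sY).
  apply: (@le_trans _ _ (\sum_(s <- S) h1 (a s x) + #|` visits a S x Y|%:R)); last first.
    by rewrite lerD2l ler_nat.
  rewrite visits_sum -big_split /=; apply: ler_sum => s _.
  have [Ys|nY] := pselect (Y (a s x)).
    rewrite asboolT //=; have := pos_part_ge0 (h (a s x) - c^-1 * rho (a s x)).
    by have /andP[_] := h01 (a s x); rewrite /h1; lra.
  rewrite asboolF // addr0 /h1 (_ : rho (a s x) = 0).
    by rewrite mulr0 subr0 pos_part_ge.
  apply: big1_seq => p /andP[_ pP]; apply/eqP; rewrite eq_le phi0 andbT leNgt.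
  by apply/negP => /phiP Up; apply: nY; exists p.
Qed.

Lemma marker_comparison : comparison R a.
Proof.
move=> A B Ac Bo AB.
have [[x0 _]|X0] := pselect (exists x : X, True); last first.
  exists 0%N, (fun=> set0), (fun=> 1%g); split; try by case.
  by move=> x _; case: X0; exists x.
have [E EAB] := uniform_visits G_count G_FC X_compact X_metrizable ha Ac Bo AB.
have EB x : exists2 g, g \in E & B (a g x).
  have : (0 < #|` visits a E x B|)%N by apply: leq_trans (EAB x).
  by rewrite cardfs_gt0 => /fset0Pn[g /visitsP[]]; exists g.
have E0 : E != fset0 by have [g gE _] := EB x0; apply/fset0Pn; exists g.
have [f [h [[fc hc] fh01 fA hB fh]]] := gap_functions X_compact X_metrizable ha Ac Bo EAB.
pose n := #|` E|; have n0 : (0 < n)%N by rewrite cardfs_gt0.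
have nR : 1 <= n%:R :> R by rewrite ler1n.
(* [N] forces the shapes to be large: each will contain a translate of the set of inverses of [N],
   hence at least [8 * n * n] elements. *)
have [N card_N] := infinite_fset (8 * n * n) G_count.
pose K := (1%g |` ([fset g^-1%g | g in E] `|` N))%fset.
have [|k [S0 castle]] := castle_with_small_complement G_FC X_compact X_metrizable ha
  a_free a_marker K (e := (8 * n)%:R^-1 : R).
  by rewrite invr_gt0 ltr0n muln_gt0.
(* The reserve is made once [k] and [S0] are known, and it provides the [L] for which the castle is
   then built. *)
have [h1 [W [L [h1c h1h WP [LW Wdis] loss]]]] := reserve S0 k Bo hc (fun z => (fh01 z).2) EB.
have [U [V [Uo LU VS Vo [Vdis sU]]]] := castle L.
(* The factor keeps [l * h1] below 1, as the matching inside the towers requires. *)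
pose l : R := 1 - (8 * n)%:R^-1.
have n8 : n%:R * (8 * n)%:R^-1 = 8^-1 :> R.
  by rewrite natrM invfM mulrCA divff ?mulr1 // gt_eqF // (lt_le_trans ltr01).
have l01 : 0 < ((8 * n)%:R^-1 : R) <= 8^-1.
  rewrite invr_gt0 ltr0n muln_gt0 n0 /= lef_pV2 ?posrE ?ltr0n ?muln_gt0 ?n0 //.
  by rewrite ler_nat leq_pmulr.
have levels_sub : is_subequivalent a (A `&` \bigcup_D levels a D (V D)) [set z | 0 < l * h1 z].
  apply: (castle_subequivalent ha (B := S0) (f := f) (l := l)) => //.
  - by move=> D /VS[].
  - by move=> z; apply: cvgM; [exact: cst_continuous|exact: h1c].
  - by move=> z; have [/andP[]] := fh01 z.
  - move=> z; have /andP[h10 hh] := h1h z; have [_ /andP[_ hz]] := fh01 z.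
    by rewrite mulr_ge0 ?ler_piMr ?(le_trans hh) // /l; lra.
  - by rewrite /l; lra.
  - move=> D x Vx; have [DS DK] := VS D (ex_intro _ x Vx).
    have K1 : 1%g \in K by rewrite in_fset1U eqxx.
    have KE g : g \in E -> (g^-1)%g \in K.
      move=> gE; rewrite in_fset1U in_fsetU; apply/orP; right; apply/orP; left.
      by apply/imfsetP; exists g.
    have := @invariant_sum_ge R G X a ha (fun z => h z - f z) K E D x.
    move=> /(_ _ fh K1 KE E0 DK) gap.
    have card_D : (8 * n * n <= #|` D|)%N.
      have [S' [_ lt SK]] := invariant_shape_core K1 DK.
      have : S' != fset0.
        apply: contraTneq lt => ->; rewrite cardfs0 -leNgt mulr_ge0 //; lra.
      move=> /fset0Pn[t tS]; rewrite -card_N.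
      have <- : #|` [fset (g^-1 * t)%g | g in N]%fset| = #|` N|.
        by apply: card_fset_image => g g' /mulIg/invg_inj.
      apply/fsubset_leq_card/fsubsetP => _ /imfsetP[g /= gN ->]; apply: SK => //.
      by rewrite !in_fsetE gN !orbT.
    have {}gap : #|` D|%:R <= 4 * n%:R * (\sum_(s <- D) h (a s x) - \sum_(s <- D) f (a s x)).
      rewrite -sumrB; apply: gap => z; have [/andP[? ?] /andP[? ?]] := fh01 z; lra.
    have hD : \sum_(s <- D) h (a s x) <= #|` D|%:R.
      rewrite -[leRHS]mulr1 -sumr_const_size; apply: ler_sum => s _.
      by have [_ /andP[]] := fh01 (a s x).
    rewrite -mulr_sumr; apply: (discounted_gap nR l01 n8 gap hD _ (loss D x DS)).
    by rewrite -!natrM ler_nat.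
have rest_sub := small_subequivalent ha
  (fun i ik => lfree_subequivalent ha Uo (let: And3 Wo _ _ := WP i in Wo) LU (LW i ik)) Wdis sU.
have h1W z : [set z | 0 < l * h1 z] z -> ~ [set z | exists2 i, (i < k)%N & W i z] z.
  move=> /= hz [i ik Wz]; have [_ _ h0] := WP i.
  by move: hz; rewrite (h0 _ ik Wz) mulr0 ltxx.
apply: subequivalent_sub _ _ (subequivalentU h1W levels_sub rest_sub).
- move=> z Az; have [lz|] := pselect ((\bigcup_D levels a D (V D)) z); by [left|right].
- move=> z [/= hz|[i _]]; last by have [_ WB _] := WP i; exact: WB.
  apply: hB; have /andP[h10 hh] := h1h z; apply: lt_le_trans hh.
  rewrite lt_neqAle h10 andbT eq_sym; apply: contraTneq hz => ->.
  by rewrite mulr0 ltxx.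
Qed.

End Comparison.

Theorem corollary5 (R : realType) (G : groupType) (X : topologicalType)
    (a : G -> X -> X)
    (G_count : countably_infinite G) (G_FC : FC_group G)
    (X_compact : compact [set: X]) (X_metrizable : metrizable R X)
    (a_action : acts_by_homeomorphisms a) (a_free : is_free_action a) :
  marker_property a <-> URPC R a.
Proof.
split=> [a_marker|[urp _]].
  split; first exact: marker_URP.
  exact: marker_comparison.
exact: URP_marker urp.
Qed.
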